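(* Let $0<\lambda_1<\lambda_2<\infty$. Almost surely, for every $p\in[0,1]$, the network $(\mathbb{Z}^2,\mathbf{C}_{\lambda_1},\mathbf{C}_{\lambda_2},p)$ has unique currents.
   Context: $\mathbb{Z}^2$ is the nearest-neighbour square lattice $G=(V,E)$ with root $o=\mathbf{0}$. A network $(G,\mathbf{c})$ is a graph with a conductance function $\mathbf{c}$ on $E$; $\mathbf{r}=1/\mathbf{c}$ is the resistance. For $\lambda>0$ and $e=\{x,y\}\in E$ let $|e|=\min\{\mathrm{dist}(x,o),\mathrm{dist}(y,o)\}$ (graph distance) and $\mathbf{C}_\lambda(e)=\lambda^{-|e|}$. Grand coupling: let $(U_e)_{e\in E}$ be i.i.d. uniform on $[0,1]$. For $p\in[0,1]$, edge $e$ is open in Bernoulli-$p$ bond percolation $\omega_p$ if $U_e\le p$ and closed otherwise. The disordered random network $(G,\mathbf{c}_1,\mathbf{c}_2,p)$ is the random network on $G$ in which every open edge $e$ of $\omega_p$ has conductance $\mathbf{c}_1(e)$ and every closed edge $e$ has conductance $\mathbf{c}_2(e)$; all $p\in[0,1]$ are realized on the same probability space via $(U_e)$. A (finite-energy) current on a network $(G,\mathbf{c})$ is an antisymmetric function $i$ on directed edges satisfying Ohm's law $i(xy)=\mathbf{c}(\{x,y\})(v(x)-v(y))$ for some function $v:V\to\mathbb{R}$, and having finite energy $\frac12\sum_{xy}i(xy)^2\,\mathbf{r}(\{x,y\})<\infty$, the sum being over directed edges. For such $i$ put $\mathrm{d}^*i(x)=\sum_{y\sim x}i(xy)$, $x\in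 V$. Currents are unique on $(G,\mathbf{c})$ if for any two currents $i,i'$ with $\mathrm{d}^*i=\mathrm{d}^*i'$ one has $i=i'$. On a connected network with positive conductances this is equivalent to: every harmonic function $f:V\to\mathbb{R}$ on the network with $\sum_{\{x,y\}\in E}\mathbf{c}(\{x,y\})(f(x)-f(y))^2<\infty$ is constant. *)

(* Defs.v *)
From mathcomp Require Import all_boot all_order all_algebra finmap.
From mathcomp Require Import all_classical all_reals all_analysis.

Set Implicit Arguments.
Unset Strict Implicit.
Unset Printing Implicit Defensive.
Import Order.TTheory GRing.Theory Num.Theory.
Local Open Scope fset_scope.
Local Open Scope classical_set_scope.
Local Open Scope ring_scope.

(* Junk value 0 on the empty set. *)
Definition nat_min (A : set nat) : nat :=
  xget 0%N [set n | A n /\ forall m, A m -> (n <= m)%N].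

(* A graph is given by a symmetric irreflexive adjacency relation. Functions of
   an undirected edge have type {fset V} -> _ and only their values on
   [edges adj] matter; functions of a directed edge have type V -> V -> _ and
   only their values on pairs in [arcs adj] matter. *)
Section Graphs.
Variables (V : choiceType) (adj : rel V).

Definition arcs : set (V * V) := [set a | adj a.1 a.2].

Definition edges : set {fset V} := [set [fset a.1; a.2] | a in arcs].

Definition graph_dist (x y : V) : nat :=
  nat_min [set size s | s in [set s : seq V | path adj x s /\ last x s = y]].

Definition edge_dist (o : V) (e : {fset V}) : nat :=
  nat_min [set graph_dist x o | x in [set` e]].

End Graphs.

Section Networks.
Variables (R : realType) (V : choiceType) (adj : rel V).

Definition Clambda (o : V) (lambda : R) : {fset V} -> R :=
  fun e => lambda ^- edge_dist adj o e.

Definition resistance (c : {fset V} -> R) : {fset V} -> R := fun e => (c e)^-1.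

Definition antisymmetric_flow (i : V -> V -> R) : Prop :=
  forall x y, adj x y -> i y x = - i x y.

Definition ohm (c : {fset V} -> R) (i : V -> V -> R) : Prop :=
  exists v : V -> R, forall x y, adj x y -> i x y = c [fset x; y] * (v x - v y).

Definition energy (c : {fset V} -> R) (i : V -> V -> R) : \bar R :=
  ((2^-1)%:E *
   \esum_(a in arcs adj)
     (i a.1 a.2 ^+ 2 * resistance c [fset a.1; a.2])%:E)%E.

Definition current (c : {fset V} -> R) (i : V -> V -> R) : Prop :=
  [/\ antisymmetric_flow i, ohm c i & (energy c i < +oo)%E].

(* The finitely supported sum is 0 by convention if i x y != 0 for infinitely
   many neighbours y; on a locally finite graph this never happens. *)
Definition dstar (i : V -> V -> R) (x : V) : R :=
  \sum_(y \in [set y | adj x y]) i x y.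

Definition unique_currents (c : {fset V} -> R) : Prop :=
  forall i i' : V -> V -> R, current c i -> current c i' ->
    (forall x, dstar i x = dstar i' x) ->
    forall x y, adj x y -> i x y = i' x y.

End Networks.

Section Percolation.
Variables (R : realType) (V : choiceType).

Definition percolation (u : {fset V} -> R) (p : R) : set {fset V} :=
  [set e | u e <= p].

Definition disordered (c1 c2 : {fset V} -> R) (u : {fset V} -> R) (p : R) :
    {fset V} -> R :=
  fun e => if e \in percolation u p then c1 e else c2 e.

End Percolation.

Section Probability.
Variables (R : realType) (d : measure_display) (Omega : measurableType d).
Variables (P : probability Omega R).

Definition mutually_independent (I : choiceType) (E : set I)
    (X : I -> {RV P >-> R}) : Prop :=
  forall (J : {fset I}) (A : I -> set R), [set` J] `<=` E ->
    (forall e, measurable (A e)) ->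
    P (\bigcap_(e in [set` J]) (X e @^-1` A e)) =
    (\prod_(e <- J) P (X e @^-1` A e))%E.

Definition uniform01 (X : {RV P >-> R}) : Prop :=
  forall A : set R, measurable A ->
    distribution P X A = uniform_prob (@ltr01 R) A.

Definition iid_uniform01 (I : choiceType) (E : set I)
    (X : I -> {RV P >-> R}) : Prop :=
  mutually_independent E X /\ (forall e, E e -> uniform01 (X e)).

End Probability.

Definition Z2 := (int * int)%type.

Definition Z2_origin : Z2 := (0, 0).

Definition Z2_adj : rel Z2 :=
  fun x y => `|x.1 - y.1| + `|x.2 - y.2| == 1.

(* Main.v *)
Require Import Defs.
From mathcomp Require Import all_boot all_order all_algebra finmap.
From mathcomp Require Import all_classical all_reals all_analysis.
From mathcomp Require Import zify lra ring.
Set Implicit Arguments.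
Unset Strict Implicit.
Unset Printing Implicit Defensive.
Import Order.TTheory GRing.Theory Num.Theory.
Local Open Scope fset_scope.
Local Open Scope classical_set_scope.
Local Open Scope ring_scope.

(* The difference of two currents is the flow of a harmonic function f of finite
   energy. If the network has finitely supported cutoffs of arbitrarily small energy
   that are 1 on any given box, then f is constant; applied to the harmonic
   conjugate of f, the same holds if the planar dual network, with inverse
   conductances, has such cutoffs. If lambda1 >= 1 the conductances are at most 1, and
   if lambda2 <= 1 the dual ones are, so logarithmic cutoffs exist. Otherwise, at
   p = 1/2 almost surely neither the open clusters nor the closed dual clusters
   percolate (Harris). The indicator of the open cluster of a box has, for every
   p <= 1/2, an energy which is part of the tail of the convergent sum of the
   lambda2^-|e|, since its boundary edges are closed. Dually for p >= 1/2, with the sum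
   of the lambda1^|e|. Monotonicity in p thus gives all p simultaneously.

   Harris' theorem comes from self-duality and from Tassion's form of the
   Russo-Seymour-Welsh argument, which uses only positive association and lattice
   symmetries; it gives circuits in infinitely many disjoint annuli. *)

(** * Independent fair bits *)

(** When [lambda1 < 1 < lambda2], open conductances grow and closed ones decay exponentially with
    the distance, so neither the network nor its dual is dominated by the unit lattice and no
    deterministic cutoff is at hand: percolation has to place the boundary of a finite region on
    edges of the cheap kind. Boundary edges at distance at least m then cost at most the tail of a
    geometric series over the whole lattice, whatever the size and shape of the region. So only
    finiteness of the cluster of each box matters, and crossing estimates with a fixed probability
    at infinitely many scales are enough for that.

    All percolation events used depend on finitely many edges. Their probabilities are finite
    averages over fair bits, and only these numbers are carried to [Omega], by independence.

    Vertices, faces and edge midpoints share one doubled lattice. A dual path is then an ordinary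
    lattice path of closed points, duality is a shift by an odd vector together with a negation, and
    one meeting lemma for lattice paths serves all gluings. *)

Section FairBits.
Variables (R : realFieldType) (T : eqType).
Implicit Types (s t : seq T) (f g : (T -> bool) -> R) (sg : T -> bool).

Definition upd sg (x : T) (b : bool) : T -> bool :=
  fun y => if y == x then b else sg y.

(* Average of [f] over independent fair bits at the points of [s], the other
   bits being those of [sg]; repetitions in [s] are harmless. *)
Fixpoint Ex s f sg : R :=
  if s is x :: s' then (Ex s' f (upd sg x true) + Ex s' f (upd sg x false)) / 2
  else f sg.

Definition dep_on (X : Type) s (f : (T -> bool) -> X) :=
  forall sg sg', {in s, sg =1 sg'} -> f sg = f sg'.

Lemma eq_Ex s f g sg : f =1 g -> Ex s f sg = Ex s g sg.
Proof. by move=> fg; elim: s sg => //= x s IH sg; rewrite !IH. Qed.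

Lemma Ex_cst s (k : R) sg : Ex s (fun=> k) sg = k.
Proof. by elim: s sg => //= x s IH sg; rewrite !IH; field. Qed.

Lemma ExD s f g sg : Ex s (fun u => f u + g u) sg = Ex s f sg + Ex s g sg.
Proof. by elim: s sg => //= x s IH sg; rewrite !IH; field. Qed.

Lemma ExZ s k f sg : Ex s (fun u => k * f u) sg = k * Ex s f sg.
Proof. by elim: s sg => //= x s IH sg; rewrite !IH; field. Qed.

Lemma ler_Ex s f g sg : (forall u, f u <= g u) -> Ex s f sg <= Ex s g sg.
Proof.
move=> fg; elim: s sg => //= x s IH sg.
have := IH (upd sg x true); have := IH (upd sg x false); lra.
Qed.

Lemma upd_eq sg x b : upd sg x b x = b.
Proof. by rewrite /upd eqxx. Qed.

Lemma updC sg x y b b' : x != y -> upd (upd sg x b) y b' = upd (upd sg y b') x b.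
Proof.
move=> xy; apply/funext => z; rewrite /upd.
by case: (eqVneq z y) => [->|//]; rewrite eq_sym (negPf xy).
Qed.

Lemma ExC s t f sg : Ex s (Ex t f) sg = Ex t (Ex s f) sg.
Proof.
elim: s sg => //= x s IH sg; rewrite !IH.
elim: t sg {IH} => //= y t IH sg; rewrite -!IH.
have [<-|xy] := eqVneq x y; last first.
  by rewrite !(updC _ _ _ xy); lra.
have E b b' : upd (upd sg x b) x b' = upd sg x b'.
  by apply/funext => z; rewrite /upd; case: (z == x).
by rewrite !E; lra.
Qed.

Lemma dep_Ex s f sg sg' : dep_on s f -> Ex s f sg = Ex s f sg'.
Proof.
move=> df.
(* Restricting to configurations that equal [sg] and [sg'] outside [s] gives a form of the
   hypothesis that passes to the tail of [s]. *)
have {df} : forall u u', {in s, u =1 u'} -> (forall x, x \notin s -> u x = sg x) ->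
    (forall x, x \notin s -> u' x = sg' x) -> f u = f u'.
  by move=> u u' uu' _ _; apply: df.
elim: s sg sg' => /= [sg sg' H|x s IH sg sg' H].
  by apply: H => // x; rewrite in_nil.
congr (_ / _); congr (_ + _); apply: IH => u u' uu' H1 H2;
  (apply: H => z; first 1 last;
   [by rewrite inE negb_or => /andP[/negPf zx zs]; rewrite H1 // /upd zx
   |by rewrite inE negb_or => /andP[/negPf zx zs]; rewrite H2 // /upd zx
   |rewrite inE => /orP[/eqP->|/uu'//];
    by have [/uu'//|xs] := boolP (x \in s); rewrite H1 ?H2 // !upd_eq]).
Qed.

(** Either average is a constant function, so both equal the double average, whose order [ExC]
    exchanges. This makes the probability of a local event independent of the chosen support. *)
Lemma dep_Ex2 s t f sg sg' : dep_on s f -> dep_on t f -> Ex s f sg = Ex t f sg'.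
Proof.
move=> ds dt.
rewrite -[LHS](Ex_cst t _ sg) -[RHS](Ex_cst s _ sg).
rewrite (eq_Ex _ _ (fun u => dep_Ex sg u ds)) ExC.
by apply: eq_Ex => u; apply: dep_Ex.
Qed.

Lemma Ex_mono s f sg sg' : (forall u u', (forall x, u x ==> u' x) -> f u <= f u') ->
  (forall x, sg x ==> sg' x) -> Ex s f sg <= Ex s f sg'.
Proof.
move=> mf; elim: s sg sg' => /= [sg sg'|x s IH sg sg' h]; first exact: mf.
have H b : Ex s f (upd sg x b) <= Ex s f (upd sg' x b).
  by apply: IH => z; rewrite /upd; case: ifP => // _; apply/implyP.
have := H true; have := H false; lra.
Qed.

(** Harris' inequality, by induction on the bits: the averages over the other bits are again
    monotone in the current one. *)
Lemma Ex_FKG s f g sg :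
  (forall u u', (forall x, u x ==> u' x) -> f u <= f u') ->
  (forall u u', (forall x, u x ==> u' x) -> g u <= g u') ->
  Ex s f sg * Ex s g sg <= Ex s (fun u => f u * g u) sg.
Proof.
move=> mf mg; elim: s sg => //= x s IH sg.
have le_upd z : upd sg x false z ==> upd sg x true z.
  by rewrite /upd; case: ifP => // _; apply/implyP.
have := Ex_mono s mf le_upd; have := Ex_mono s mg le_upd.
have := IH (upd sg x true); have := IH (upd sg x false).
set a := Ex s f _; set b := Ex s g _; set c := Ex s _ _.
set a' := Ex s f _; set b' := Ex s g _; set c' := Ex s _ _.
move=> h1 h2 h3 h4.
(* Chebyshev's inequality for a single bit: both increments are nonnegative. *)
have h5 : 0 <= (a' - a) * (b' - b) by rewrite mulr_ge0 // subr_ge0.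
nra.
Qed.

Lemma Ex_map (h : T -> T) s f sg : injective h ->
  Ex (map h s) (fun u => f (u \o h)) sg = Ex s f (sg \o h).
Proof.
move=> ih; elim: s sg => //= x s IH sg; rewrite !IH.
have E b : upd sg (h x) b \o h = upd (sg \o h) x b.
  by apply/funext => z; rewrite /upd /= (inj_eq ih).
by rewrite !E.
Qed.

Lemma Ex_neg s f sg :
  Ex s (fun u => f (fun x => ~~ u x)) sg = Ex s f (fun x => ~~ sg x).
Proof.
elim: s sg => //= x s IH sg; rewrite !IH.
have E b : (fun y => ~~ upd sg x b y) = upd (fun y => ~~ sg y) x (~~ b).
  by apply/funext => z; rewrite /upd; case: (z == x).
by rewrite !E /= addrC.
Qed.

Lemma Ex_indep s t f g sg : dep_on s f -> dep_on t g ->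
  {in s, forall x, x \notin t} ->
  Ex (s ++ t) (fun u => f u * g u) sg = Ex s f sg * Ex t g sg.
Proof.
move=> df dg st.
have E1 : forall s' sg', Ex (s' ++ t) (fun u => f u * g u) sg' =
    Ex s' (Ex t (fun u => f u * g u)) sg'.
  by elim=> //= x s' IH sg'; rewrite !IH.
have E2 u : Ex t (fun v => f v * g v) u = f u * Ex t g u.
  rewrite -ExZ.
  (* Averaging over [t] never changes a bit of [s], so [f] can be frozen at its value at [u]. *)
  have : forall u0, {in s, u0 =1 u} -> Ex t (fun v => f v * g v) u0 =
      Ex t (fun v => f u * g v) u0.
    elim: t st {dg E1} => [|y t IH] st u0 u0u /=; first by rewrite (df _ _ u0u).
    by rewrite !IH // => x xs; rewrite ?u0u //;
       have := st _ xs; rewrite inE negb_or => /andP[xy xt]; rewrite // /upd (negPf xy) u0u.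
  by apply.
rewrite E1 (eq_Ex _ _ E2).
rewrite mulrC -ExZ; apply: eq_Ex => u.
by rewrite (dep_Ex u sg dg) mulrC.
Qed.

End FairBits.

(** * Critical bond percolation on local events *)

Notation coloring := (Z2 -> bool).

Definition is_vertex (z : Z2) := ((z.1 %% 2)%Z == 0) && ((z.2 %% 2)%Z == 0).
Definition is_face (z : Z2) := ((z.1 %% 2)%Z != 0) && ((z.2 %% 2)%Z != 0).

(* Bond percolation drawn on the doubled lattice: points with two even
   coordinates are the vertices (always open), points with two odd coordinates
   are the faces (always closed), the others are the midpoints of the edges. *)
Definition coloring_of (sg : Z2 -> bool) : coloring :=
  fun z => is_vertex z || ~~ is_face z && sg z.

Definition proper_coloring (c : coloring) :=
  forall z, (is_vertex z -> c z) /\ (is_face z -> ~~ c z).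

Lemma coloring_of_proper sg : proper_coloring (coloring_of sg).
Proof.
move=> z; split; first by rewrite /coloring_of => ->.
by rewrite /coloring_of => h; rewrite h orbF; move: h; rewrite /is_face /is_vertex; lia.
Qed.

Definition supported (s : seq Z2) (A : coloring -> Prop) :=
  forall c c', {in s, c =1 c'} -> A c -> A c'.

Definition local (A : coloring -> Prop) := exists s, supported s A.

Definition increasing (A : coloring -> Prop) :=
  forall c c' : coloring, (forall z, c z -> c' z) -> A c -> A c'.

Lemma supported_sub s t A : {subset s <= t} -> supported s A -> supported t A.
Proof. by move=> st sA c c' cc'; apply: sA => z /st; apply: cc'. Qed.

Lemma supported_and s A B : supported s A -> supported s B ->
  supported s (fun c => A c /\ B c).
Proof. by move=> sA sB c c' cc' [/(sA _ _ cc') ? /(sB _ _ cc')]. Qed.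

Lemma supported_or s A B : supported s A -> supported s B ->
  supported s (fun c => A c \/ B c).
Proof. by move=> sA sB c c' cc' [/(sA _ _ cc')|/(sB _ _ cc')]; [left|right]. Qed.

Lemma supported_not s A : supported s A -> supported s (fun c => ~ A c).
Proof. by move=> sA c c' cc' nA /(sA c' c) h; apply: nA; apply: h => z /cc'. Qed.

Lemma local2 A B : local A -> local B -> exists2 s, supported s A & supported s B.
Proof.
move=> [s sA] [t sB]; exists (s ++ t).
  by apply: supported_sub sA => z; rewrite mem_cat => ->.
by apply: supported_sub sB => z; rewrite mem_cat orbC => ->.
Qed.

Lemma local_and A B : local A -> local B -> local (fun c => A c /\ B c).
Proof. by move=> lA /(local2 lA)[s sA sB]; exists s; apply: supported_and. Qed.

Lemma local_or A B : local A -> local B -> local (fun c => A c \/ B c).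
Proof. by move=> lA /(local2 lA)[s sA sB]; exists s; apply: supported_or. Qed.

Lemma local_not A : local A -> local (fun c => ~ A c).
Proof. by move=> [s sA]; exists s; apply: supported_not. Qed.

Lemma local_map (h : Z2 -> Z2) A : local A -> local (fun c => A (c \o h)).
Proof.
move=> [s sA]; exists (map h s) => c c' cc'; apply: sA => z zs /=.
by apply: cc'; apply: map_f.
Qed.

Lemma local_neg A : local A -> local (fun c => A (fun z => ~~ c z)).
Proof. by move=> [s sA]; exists s => c c' cc'; apply: sA => z zs; rewrite cc'. Qed.

Lemma increasing_and A B : increasing A -> increasing B ->
  increasing (fun c => A c /\ B c).
Proof. by move=> iA iB c c' cc' [/(iA _ _ cc') ? /(iB _ _ cc')]. Qed.

Section LocalEvents.
Variable R : realFieldType.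
Implicit Types (A B : coloring -> Prop).

Definition event_indic A (sg : Z2 -> bool) : R := (`[< A (coloring_of sg) >])%:R.

(* Probability of a local event when every edge is open with probability 1/2;
   junk value 0 for the events which are not local. *)
Definition Pr A : R :=
  if pselect (local A) is left lA
  then Ex (projT1 (cid lA)) (event_indic A) (fun=> false) else 0.

Lemma dep_on_indic s A : supported s A -> dep_on s (event_indic A).
Proof.
move=> sA sg sg' h; congr (_%:R); congr nat_of_bool; apply/asbool_equiv_eq.
by split; apply: sA => z zs; rewrite /coloring_of h.
Qed.

Lemma PrE s A sg : supported s A -> Pr A = Ex s (event_indic A) sg.
Proof.
move=> sA; rewrite /Pr; case: pselect => [lA|[]]; last by exists s.
by case: cid => t tA /=; apply: dep_Ex2; apply: dep_on_indic.
Qed.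

Lemma indic_and A B sg : event_indic (fun c => A c /\ B c) sg = event_indic A sg * event_indic B sg.
Proof. by rewrite /event_indic asbool_and -natrM mulnb. Qed.

Lemma Pr_ge0 A : 0 <= Pr A.
Proof.
rewrite /Pr; case: pselect => // lA.
by rewrite -(@Ex_cst R _ (projT1 (cid lA)) 0 (fun=> false)); apply: ler_Ex.
Qed.

(** [coloring_of] produces proper colorings only, so the inclusion is asked of these; the planar
    arguments use that vertices are open and faces closed. *)
Lemma Pr_mono A B : local A -> local B -> (forall c, proper_coloring c -> A c -> B c) ->
  Pr A <= Pr B.
Proof.
move=> lA lB AB; have [s sA sB] := local2 lA lB.
rewrite (PrE (fun=> false) sA) (PrE (fun=> false) sB); apply: ler_Ex => u.
rewrite /event_indic ler_nat; case: asboolP => // /(AB _ (coloring_of_proper u)) h.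
by case: asboolP.
Qed.

Lemma Pr_not A : local A -> Pr (fun c => ~ A c) = 1 - Pr A.
Proof.
move=> [s sA]; rewrite (PrE (fun=> false) sA) (PrE (fun=> false) (supported_not sA)).
apply/eqP; rewrite eq_sym subr_eq; apply/eqP.
rewrite -(ExD s) -[LHS](@Ex_cst R _ s 1 (fun=> false)); apply: eq_Ex => u.
by rewrite /event_indic asbool_neg; case: asboolP => _; rewrite ?addr0 ?add0r.
Qed.

Lemma Pr_or A B : local A -> local B -> Pr (fun c => A c \/ B c) <= Pr A + Pr B.
Proof.
move=> lA lB; have [s sA sB] := local2 lA lB.
rewrite (PrE (fun=> false) sA) (PrE (fun=> false) sB).
rewrite (PrE (fun=> false) (supported_or sA sB)) -(ExD s); apply: ler_Ex => u.
by rewrite /event_indic asbool_or; do 2 case: asboolP => _; rewrite ?addr0 ?add0r ?lerDl.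
Qed.

Lemma Pr_FKG A B : local A -> local B -> increasing A -> increasing B ->
  Pr A * Pr B <= Pr (fun c => A c /\ B c).
Proof.
move=> lA lB iA iB; have [s sA sB] := local2 lA lB.
rewrite (PrE (fun=> false) sA) (PrE (fun=> false) sB).
rewrite (PrE (fun=> false) (supported_and sA sB)).
rewrite (eq_Ex _ _ (indic_and A B)).
have I C : increasing C ->
    forall u u', (forall x, u x ==> u' x) -> event_indic C u <= event_indic C u'.
  move=> iC u u' uu'; rewrite /event_indic ler_nat; case: asboolP => // h.
  case: asboolP => // -[]; apply: iC h => z; rewrite /coloring_of.
  by case: is_vertex => //= /andP[-> /(implyP (uu' z))].
by apply: Ex_FKG; apply: I.
Qed.

(** Harris' inequality for the complements, followed by inclusion-exclusion. *)
Lemma Pr_FKG_dec A B : local A -> local B ->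
  increasing (fun c => ~ A c) -> increasing (fun c => ~ B c) ->
  Pr A * Pr B <= Pr (fun c => A c /\ B c).
Proof.
move=> lA lB iA iB.
have := Pr_FKG (local_not lA) (local_not lB) iA iB.
rewrite !Pr_not //.
have lAB := local_or (local_not lA) (local_not lB).
have lNN := local_and (local_not lA) (local_not lB).
have [s sA sB] := local2 lA lB.
suff -> : Pr (fun c => ~ A c /\ ~ B c) =
    1 - Pr A - Pr B + Pr (fun c => A c /\ B c) by lra.
rewrite (PrE (fun=> false) (supported_and (supported_not sA) (supported_not sB))).
rewrite (PrE (fun=> false) (supported_and sA sB)).
rewrite (PrE (fun=> false) sA) (PrE (fun=> false) sB).
rewrite -{1}(@Ex_cst R _ s 1 (fun=> false)) -!(mulN1r (Ex _ _ _)) -!ExZ -!ExD.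
apply: eq_Ex => u; rewrite /event_indic !asbool_and !asbool_neg.
by do 2 case: asboolP => _ /=; lra.
Qed.

Lemma Pr_indep s t A B : supported s A -> supported t B ->
  {in s, forall x, x \notin t} -> Pr (fun c => A c /\ B c) = Pr A * Pr B.
Proof.
move=> sA tB st.
have sA' : supported (s ++ t) A.
  by apply: supported_sub sA => z; rewrite mem_cat => ->.
have sB' : supported (s ++ t) B.
  by apply: supported_sub tB => z; rewrite mem_cat orbC => ->.
rewrite (PrE (fun=> false) sA) (PrE (fun=> false) tB).
rewrite (PrE (fun=> false) (supported_and sA' sB')) (eq_Ex _ _ (indic_and A B)).
by apply: Ex_indep => //; apply: dep_on_indic.
Qed.

Lemma Pr_map (h : Z2 -> Z2) A : local A -> injective h ->
  (forall z, is_vertex (h z) = is_vertex z) -> (forall z, is_face (h z) = is_face z) ->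
  Pr (fun c => A (c \o h)) = Pr A.
Proof.
move=> [s sA] ih hv hf.
have sAh : supported (map h s) (fun c => A (c \o h)).
  by move=> c c' cc'; apply: sA => z zs /=; apply: cc'; apply: map_f.
rewrite (PrE (fun=> false) sAh) (PrE ((fun=> false) \o h) sA) -(Ex_map _ _ _ ih).
apply: eq_Ex => u; congr (_%:R); congr nat_of_bool; congr asbool; congr A.
by apply/funext => z; rewrite /coloring_of /= hv hf.
Qed.

(* Planar self-duality: exchanging vertices with faces and open with closed
   preserves the measure. *)
Lemma Pr_dual (h : Z2 -> Z2) A : local A -> injective h ->
  (forall z, is_vertex (h z) = is_face z) -> (forall z, is_face (h z) = is_vertex z) ->
  Pr (fun c => A (fun z => ~~ c (h z))) = Pr A.
Proof.
move=> [s sA] ih hv hf.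
have sAh : supported (map h s) (fun c => A (fun z => ~~ c (h z))).
  by move=> c c' cc'; apply: sA => z zs /=; rewrite cc' //; apply: map_f.
rewrite (PrE (fun=> false) sAh) (PrE (fun x => ~~ ((fun=> false) \o h) x) sA).
rewrite -[RHS]Ex_neg -(Ex_map _ _ _ ih).
apply: eq_Ex => u; congr (_%:R); congr nat_of_bool; congr asbool; congr A.
apply/funext => z; rewrite /coloring_of /= hv hf.
have : ~~ (is_vertex z && is_face z) by rewrite /is_vertex /is_face; lia.
by case: is_vertex; case: is_face; case: (u _).
Qed.

End LocalEvents.

(** * Planar topology of the square lattice *)

Lemma Z2_adjC : symmetric Z2_adj.
Proof. by move=> x y; rewrite /Z2_adj (distrC x.1) (distrC x.2). Qed.

Definition conn (K : pred Z2) (x y : Z2) : Prop :=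
  exists s, [/\ path Z2_adj x s, last x s = y & all K (x :: s)].

Lemma conn_refl (K : pred Z2) x : K x -> conn K x x.
Proof. by move=> Kx; exists [::]; rewrite /= Kx. Qed.

Lemma conn_trans K x y z : conn K x y -> conn K y z -> conn K x z.
Proof.
move=> [s [ps <- /= /andP[Kx Ks]]] [t [pt <- /= /andP[_ Kt]]].
by exists (s ++ t); rewrite cat_path last_cat /= all_cat Kx Ks Kt ps pt.
Qed.

Lemma conn_memr K x y : conn K x y -> K y.
Proof. by move=> [s [_ <- /allP h]]; apply/h/mem_last. Qed.

Lemma conn_meml K x y : conn K x y -> K x.
Proof. by move=> [s [_ _ /andP[]]]. Qed.

Lemma conn_step (K : pred Z2) x y : K x -> K y -> Z2_adj x y -> conn K x y.
Proof. by move=> Kx Ky xy; exists [:: y]; rewrite /= Kx Ky xy. Qed.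

Lemma conn_rcons (K : pred Z2) x y z : conn K x y -> K z -> Z2_adj y z -> conn K x z.
Proof. by move=> h Kz yz; apply: (conn_trans h); apply: conn_step yz => //; apply: conn_memr h. Qed.

Lemma conn_ind (K : pred Z2) (Q : Z2 -> Prop) x y : conn K x y -> Q x ->
  (forall u v, K u -> K v -> Z2_adj u v -> Q u -> Q v) -> Q y.
Proof.
move=> [s [ps <- {y}]]; elim: s x ps => //= z s IH x /andP[xz ps] /and3P[Kx Kz Ks] Qx h.
by apply: IH => //=; rewrite ?Kz //; apply: h xz Qx.
Qed.

Lemma conn_sym K x y : conn K x y -> conn K y x.
Proof.
move=> h; have Kx := conn_meml h.
apply: (conn_ind (Q := fun z => conn K z x) h); first exact: conn_refl.
by move=> u v Ku Kv uv h'; apply: conn_trans h'; apply: conn_step => //; rewrite Z2_adjC.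
Qed.

Lemma conn_sub (K K' : pred Z2) x y : (forall z, K z -> K' z) -> conn K x y -> conn K' x y.
Proof. by move=> KK' [s [ps ls Ks]]; exists s; split => //; apply: sub_all Ks. Qed.

Lemma conn_map (g : Z2 -> Z2) (K K' : pred Z2) x y :
  (forall u v, Z2_adj u v -> Z2_adj (g u) (g v)) -> (forall z, K z -> K' (g z)) ->
  conn K x y -> conn K' (g x) (g y).
Proof.
move=> ag KK' h; apply: (conn_ind (Q := fun z => conn K' (g x) (g z)) h); first by apply: conn_refl; apply/KK'/conn_meml/h.
by move=> u v Ku Kv uv h'; apply: (conn_rcons h'); [apply: KK'|apply: ag].
Qed.

Lemma conn_component K x y : conn K x y -> conn (fun z => `[< conn K x z >]) x y.
Proof.
move=> h; have Kx := conn_meml h.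
pose K' z := `[< conn K x z >]; apply: (conn_ind (Q := conn K' x) h).
  by apply: conn_refl; apply/asboolP/conn_refl.
move=> u v Ku Kv uv h'; apply: (conn_rcons h') => //; apply/asboolP.
by apply: conn_rcons uv => //; apply/asboolP/(conn_memr h').
Qed.

Definition lipschitz1 (h : Z2 -> int) := forall u v, Z2_adj u v -> `|h u - h v| <= 1.

Lemma conn_first_hit (h : Z2 -> int) (K : pred Z2) x y b : lipschitz1 h ->
  conn K x y -> h x <= b <= h y ->
  exists2 y', h y' = b & conn (fun z => K z && (h z <= b)) x y'.
Proof.
move=> lh [s [ps <- {y}]]; elim: s x ps => [|z s IH] x /=.
  by move=> _ /andP[Kx _] hx; exists x; [lia|apply: conn_refl; rewrite Kx; lia].
move=> /andP[xz ps] /and3P[Kx Kz Ks] hx.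
have [hxb|hxb] := eqVneq (h x) b.
  by exists x => //; apply: conn_refl; rewrite Kx hxb /=.
have hz : h z <= b by have := lh _ _ xz; lia.
have [||y' hy' cy'] := IH z ps; rewrite /= ?Kz //; first by lia.
exists y' => //; apply: conn_trans cy'; apply: conn_step => //; rewrite ?Kx ?Kz /=; lia.
Qed.

(** Discrete intermediate values: the path is cut at its first visit to level [b], then reversed and
    cut at its first visit to level [a], which is [conn_first_hit] for [- h]. *)
Lemma conn_crossing (h : Z2 -> int) (K : pred Z2) x y a b : lipschitz1 h ->
  conn K x y -> h x <= a -> a <= b -> b <= h y ->
  exists x' y', [/\ h x' = a, h y' = b & conn (fun z => K z && (a <= h z <= b)) x' y'].
Proof.
move=> lh cxy ha hab hb.
have [|y' hy' /conn_sym cy'] := conn_first_hit lh cxy (b := b); first lia.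
have lh' : lipschitz1 (fun z => - h z) by move=> u v /lh; lia.
have [|x' hx' cx'] := conn_first_hit lh' cy' (b := - a); first lia.
exists x', y'; split; [lia|done|apply: conn_sym; apply: conn_sub cx'].
by move=> z /andP[/andP[-> zb] za] /=; lia.
Qed.

Definition rect (a b c d : int) : pred Z2 := fun z => (a <= z.1 <= b) && (c <= z.2 <= d).

(* Parity of the number of steps of the walk [p :: s] that cross the vertical
   half-line going up from [z + (1/2, 1/2)]. *)
Definition crosses (z p q : Z2) : bool :=
  [&& p.2 == q.2, z.2 < p.2 &
    (p.1 == z.1) && (q.1 == z.1 + 1) || (q.1 == z.1) && (p.1 == z.1 + 1)].

Fixpoint parity (z p : Z2) (s : seq Z2) : bool :=
  if s is q :: s' then crosses z p q (+) parity z q s' else false.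

(** The only steps counted from [z] but not from the point above it are horizontal ones ending at
    that point, which the walk avoids. *)
Lemma parity_up (z p : Z2) s : path Z2_adj p s -> (z.1, z.2 + 1) \notin p :: s ->
  parity (z.1, z.2 + 1) p s = parity z p s.
Proof.
elim: s p => //= q s IH p /andP[pq ps]; rewrite !inE !negb_or => /and3P[zp zq zs].
rewrite IH // ?inE ?negb_or ?zq //; congr addb.
move: pq zp zq; rewrite /crosses /Z2_adj -!pair_eqE /=; lia.
Qed.

(** A step that crosses one of the two half-lines enters or leaves the half-column between them. The
    walk cannot enter it from below, since it avoids [(z.1 + 1, z.2)], and it starts and ends
    outside, so there is an even number of such steps. *)
Lemma parity_right (z p : Z2) s : path Z2_adj p s -> (z.1 + 1, z.2) \notin p :: s ->
  p.1 != z.1 + 1 -> (last p s).1 != z.1 + 1 ->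
  parity (z.1 + 1, z.2) p s = parity z p s.
Proof.
pose r (u : Z2) := (u.1 == z.1 + 1) && (z.2 < u.2).
move=> ps zs hp hl.
suff : parity (z.1 + 1, z.2) p s (+) parity z p s = r p (+) r (last p s).
  by rewrite /r (negPf hp) (negPf hl) /=; do 2 case: parity.
elim: s p ps zs {hp hl} => /= [p _ _|q s IH p /andP[pq ps]]; first by rewrite addbb.
rewrite !inE !negb_or => /and3P[zp zq zs].
have E : crosses (z.1 + 1, z.2) p q (+) crosses z p q = r p (+) r q.
  move: pq zp zq; rewrite /r /crosses /Z2_adj -!pair_eqE /=.
  move: p q z {r IH ps zs} => [p1 p2] [q1 q2] [z1 z2] /=.
  case: (eqVneq p2 q2) => [<-|h] H.
    by case: (ltP z2 p2) => /= h; lia.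
  have -> : q1 = p1 by lia.
  by move=> /= h1 h2; case: (eqVneq p1 (z1 + 1)) => //= h3; lia.
rewrite addbACA E IH // ?inE ?negb_or ?zq //.
by rewrite -addbA (addbA (r q)) addbb addFb.
Qed.

Lemma parity_above (z p : Z2) s : all (fun q : Z2 => q.2 <= z.2) (p :: s) -> parity z p s = false.
Proof.
elim: s p => //= q s IH p /and3P[hp hq hs]; rewrite IH //= ?hq // addbF.
by apply/negbTE; rewrite /crosses; lia.
Qed.

(** Every passage between the columns [z.1] and [z.1 + 1] is counted: one at height [z.2] would have
    to visit [z]. *)
Lemma parity_bottom (z p : Z2) s : path Z2_adj p s -> z \notin p :: s ->
  all (fun q : Z2 => z.2 <= q.2) (p :: s) ->
  parity z p s = (p.1 <= z.1) (+) ((last p s).1 <= z.1).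
Proof.
elim: s p => /= [p _ _ _|q s IH p /andP[pq ps]]; first by rewrite addbb.
rewrite !inE !negb_or => /and3P[zp zq zs] /and3P[hp hq hs].
rewrite IH //= ?inE ?negb_or ?zq ?hq //.
suff -> : crosses z p q = (p.1 <= z.1) (+) (q.1 <= z.1).
  by rewrite -addbA (addbA (q.1 <= z.1)) addbb addFb.
move: pq zp zq hp hq; rewrite /crosses /Z2_adj -!pair_eqE /=.
move: p q z {IH ps zs hs} => [p1 p2] [q1 q2] [z1 z2] /=.
case: (eqVneq p2 q2) => [<-|h] H /= *; first by lia.
have -> : q1 = p1 by lia.
by rewrite addbb.
Qed.

(** Discrete Jordan argument: if the two paths were disjoint, the parity of the first one seen from
    a point of the second would be constant along the second, but it is odd at the bottom and even
    at the top. *)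
Lemma crossings_meet (K K' : pred Z2) a b c d x y u v :
  (forall z, K z -> rect a b c d z) -> (forall z, K' z -> rect a b c d z) ->
  conn K x y -> x.1 = a -> y.1 = b -> conn K' u v -> u.2 = c -> v.2 = d ->
  exists z, K z && K' z.
Proof.
move=> Kr Kr' [s [ps ly Ks]] xa yb cuv uc vd.
apply: contrapT => disj.
have {}disj z : K z -> K' z -> False by move=> h1 h2; apply: disj; exists z; rewrite h1.
(* One more step to the right puts the end of the walk in the column [b + 1], outside the
   rectangle. *)
pose t := rcons s (y.1 + 1, y.2).
have pt : path Z2_adj x t.
  by rewrite rcons_path ps ly /= /Z2_adj /=; apply/eqP; lia.
have lt : last x t = (y.1 + 1, y.2) by rewrite last_rcons.
have nt (z : Z2) : K' z -> z \notin x :: t.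
  move=> K'z; rewrite -rcons_cons mem_rcons inE negb_or; apply/andP; split.
    by apply/eqP => zE; have := Kr' _ K'z; rewrite zE /rect /=; lia.
  by apply/negP => /(allP Ks) Kz; apply: disj Kz K'z.
have tr (z : Z2) : z \in x :: t -> c <= z.2 <= d.
  rewrite -rcons_cons mem_rcons inE => /orP[/eqP->|/(allP Ks)/Kr]; last by rewrite /rect; lia.
  have : K y by rewrite -ly; apply: (allP Ks); apply: mem_last.
  by move=> /Kr; rewrite /rect /=; lia.
have E : parity v x t = parity u x t.
  apply: (conn_ind (Q := fun z => parity z x t = parity u x t) cuv) => // p q Kp Kq pq <-.
  have R1 (w : Z2) : K' w -> K' (w.1 + 1, w.2) -> parity (w.1 + 1, w.2) x t = parity w x t.
    move=> Kw Kw'; apply: parity_right => //; [exact: nt| |].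
      by have := Kr' _ Kw; rewrite /rect; lia.
    by have := Kr' _ Kw'; rewrite lt /rect /=; lia.
  have U1 (w : Z2) : K' w -> K' (w.1, w.2 + 1) -> parity (w.1, w.2 + 1) x t = parity w x t.
    by move=> Kw Kw'; apply: parity_up => //; exact: nt.
  have : [\/ q = (p.1 + 1, p.2), p = (q.1 + 1, q.2), q = (p.1, p.2 + 1) | p = (q.1, q.2 + 1)].
    move: pq; rewrite /Z2_adj; case: (p) (q) => [p1 p2] [q1 q2] /= pq.
    have : (q1 == p1 + 1) && (q2 == p2) || (p1 == q1 + 1) && (p2 == q2) ||
      ((q1 == p1) && (q2 == p2 + 1) || (p1 == q1) && (p2 == q2 + 1)) by lia.
    by case/orP => /orP[] /andP[/eqP-> /eqP->]; [apply: Or41|apply: Or42|apply: Or43|apply: Or44].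
  by case=> e; [rewrite e R1 -?e|rewrite [in RHS]e R1 -?e|rewrite e U1 -?e|rewrite [in RHS]e U1 -?e].
have Ku := conn_meml cuv; have Kv := conn_memr cuv.
have := E; rewrite parity_above; last by apply/allP => z /tr; lia.
rewrite parity_bottom //; [|exact: nt|by apply/allP => z /tr; lia].
by rewrite lt /=; have := Kr' _ Ku; rewrite /rect; lia.
Qed.

(** Reduction to [crossings_meet] in a rectangle with two more columns. The first path goes straight
    on to the column [b + 2]; the second is prolonged along the column [b + 1], down from [u] and up
    from [v]. The new pieces meet nothing, because [y] lies strictly between [u] and [v] once the
    cases of equality are settled. *)
Lemma gap_crossings_meet (K K' : pred Z2) a b c d x y u v :
  (forall z, K z -> rect a b c d z) -> (forall z, K' z -> rect a b c d z) ->
  conn K x y -> x.1 = a -> y.1 = b -> conn K' u v -> u.1 = b -> v.1 = b ->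
  u.2 <= y.2 <= v.2 -> exists z, K z && K' z.
Proof.
move=> Kr Kr' cxy xa yb cuv ub vb uyv.
have Ky := conn_memr cxy; have Ku := conn_meml cuv; have Kv := conn_memr cuv.
have [e|uy] := eqVneq u.2 y.2.
  have e' : y = u by apply/eqP; rewrite -pair_eqE /=; lia.
  by exists y; rewrite Ky e' Ku.
have [e|vy] := eqVneq v.2 y.2.
  have e' : y = v by apply/eqP; rewrite -pair_eqE /=; lia.
  by exists y; rewrite Ky e' Kv.
pose L : pred Z2 := fun z => K z || (z.2 == y.2) && (b + 1 <= z.1 <= b + 2).
pose L' : pred Z2 := fun z =>
  K' z || (z.1 == b + 1) && ((c <= z.2 <= u.2) || (v.2 <= z.2 <= d)).
have cL : conn L x (b + 2, y.2).
  apply: (@conn_rcons _ _ (b + 1, y.2)); last by rewrite /Z2_adj /=; lia.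
    apply: (@conn_rcons _ _ y); last by rewrite /Z2_adj /=; lia.
      by apply: conn_sub cxy => z; rewrite /L => ->.
    by rewrite /L /=; apply/orP; right; lia.
  by rewrite /L /=; apply/orP; right; lia.
have Kur := Kr' _ Ku; have Kvr := Kr' _ Kv.
have up (n : nat) : v.2 + n%:Z <= d -> conn L' v (b + 1, v.2 + n%:Z).
  elim: n => [|n IH] h.
    rewrite addr0; apply: conn_step; rewrite /Z2_adj /L' ?Kv //=; last by lia.
    by apply/orP; right; lia.
  have {}IH : conn L' v (b + 1, v.2 + n%:Z) by apply: IH; lia.
  apply: (conn_rcons IH); rewrite /Z2_adj /L' /=; last by lia.
  by apply/orP; right; move: Kvr; rewrite /rect; lia.
have down (n : nat) : c <= u.2 - n%:Z -> conn L' u (b + 1, u.2 - n%:Z).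
  elim: n => [|n IH] h.
    rewrite subr0; apply: conn_step; rewrite /Z2_adj /L' ?Ku //=; last by lia.
    by apply/orP; right; lia.
  have {}IH : conn L' u (b + 1, u.2 - n%:Z) by apply: IH; lia.
  apply: (conn_rcons IH); rewrite /Z2_adj /L' /=; last by lia.
  by apply/orP; right; move: Kur; rewrite /rect; lia.
have cL' : conn L' (b + 1, c) (b + 1, d).
  have [e1 e2] : u.2 - (`|(u.2 - c)|%N)%:Z = c /\ v.2 + (`|(d - v.2)|%N)%:Z = d.
    by move: Kur Kvr; rewrite /rect; split; lia.
  have h1 := up `|(d - v.2)|%N; have h2 := down `|(u.2 - c)|%N.
  rewrite e1 in h2; rewrite e2 in h1.
  apply: (conn_trans (conn_sym (h2 (lexx _)))).
  apply: conn_trans (h1 (lexx _)).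
  by apply: conn_sub cuv => z; rewrite /L' => ->.
have [||z] := @crossings_meet L L' a (b + 2) c d _ _ _ _ _ _ cL xa erefl cL' erefl erefl.
- move=> z /orP[/Kr|]; rewrite /rect; first lia.
  by have := Kr _ Ky; have := Kr _ (conn_meml cxy); rewrite /rect; lia.
- move=> z /orP[/Kr'|]; rewrite /rect; first lia.
  by move: Kur Kvr; rewrite /rect; lia.
rewrite /L /L' => /andP[/orP[Kz|hz] /orP[Kz'|hz']]; first by exists z; rewrite Kz.
- by have := Kr _ Kz; rewrite /rect; lia.
- by have := Kr' _ Kz'; rewrite /rect; lia.
- by lia.
Qed.

Lemma big_addb_telescope (w : nat -> bool) n :
  \big[addb/false]_(0 <= i < n) (w i (+) w i.+1) = w 0%N (+) w n.
Proof.
elim: n => [|n IH]; first by rewrite big_nil addbb.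
by rewrite big_nat_recr //= IH -addbA (addbA (w n)) addbb.
Qed.

Lemma big_addb_true (w : nat -> bool) n :
  \big[addb/false]_(0 <= i < n) w i -> exists2 i, (i < n)%N & w i.
Proof.
elim: n => [|n IH]; first by rewrite big_nil.
rewrite big_nat_recr //=; have [wn _|_] := boolP (w n); first by exists n.
by rewrite addbF => /IH[i h wi]; exists i => //; lia.
Qed.

(* Planar duality. Along each row of faces, the parity of the number of edges
   that are on the boundary of the left open cluster and are adjacent to a face
   of the bottom closed cluster is the same above and below the row; it is odd
   at the bottom. *)
Lemma open_or_closed_crossing (c : coloring) (n m : nat) : proper_coloring c ->
  (0 < n)%N -> (0 < m)%N ->
  (exists x y, [/\ x.1 = 0, y.1 = n.*2%:Z &
    conn (fun z => c z && rect 0 n.*2%:Z 0 m.*2%:Z z) x y]) \/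
  (exists x y, [/\ x.2 = 0, y.2 = m.*2%:Z &
    conn (fun z => ~~ c z && rect 1 (n.*2%:Z - 1) 0 m.*2%:Z z) x y]).
Proof.
move=> pc n0 m0.
pose K : pred Z2 := fun z => c z && rect 0 n.*2%:Z 0 m.*2%:Z z.
pose K' : pred Z2 := fun z => ~~ c z && rect 1 (n.*2%:Z - 1) 0 m.*2%:Z z.
case: (pselect (exists x y, [/\ x.1 = 0, y.1 = n.*2%:Z & conn K x y])); first by left.
move=> noLR; right.
(* [S] is the open cluster of the left side and [T] the closed cluster of the bottom. Below, [s]
   samples [S] at vertices, [t] samples [T] at faces, and [h] and [v] mark the horizontal and
   vertical edges on the boundary of [S]. *)
pose S z := `[< exists x : Z2, x.1 = 0 /\ conn K x z >].
pose T z := `[< exists x : Z2, x.2 = 0 /\ conn K' x z >].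
have SS z z' : S z -> K z' -> Z2_adj z z' -> S z'.
  move=> /asboolP[x [x0 h]] Kz' zz'; apply/asboolP; exists x; split=> //.
  exact: conn_rcons zz'.
have TT z z' : T z -> K' z' -> Z2_adj z z' -> T z'.
  move=> /asboolP[x [x0 h]] Kz' zz'; apply/asboolP; exists x; split=> //.
  exact: conn_rcons zz'.
pose s i j := S (i.*2%:Z, j.*2%:Z).
pose t i j := T (i.*2%:Z + 1, j.*2%:Z + 1).
pose h i j := s i j (+) s i.+1 j.
pose v i j := s i j (+) s i j.+1.
have vK i j : (i <= n)%N -> (j <= m)%N -> K (i.*2%:Z, j.*2%:Z).
  move=> hi hj; rewrite /K /rect /= (pc _).1 /=; first by lia.
  by rewrite /is_vertex /=; lia.
have fK i j : (i < n)%N -> (j < m)%N -> K' (i.*2%:Z + 1, j.*2%:Z + 1).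
  move=> hi hj; rewrite /K' /rect /= (pc _).2 /=; first by lia.
  by rewrite /is_face /=; lia.
have s0 j : (j <= m)%N -> s 0%N j.
  by move=> hj; apply/asboolP; exists (0%N.*2%:Z, j.*2%:Z); split=> //; apply: conn_refl; apply: vK.
have sn j : s n j = false.
  apply/negbTE/negP => /asboolP[x [x0 cx]]; apply: noLR.
  by exists x, (n.*2%:Z, j.*2%:Z).
(* A boundary edge of [S] is closed, for an open midpoint would put both its ends in [S]. Hence it
   joins the two faces beside it ([th], [tv]). *)
have hK i j : (i < n)%N -> (j <= m)%N -> h i j -> K' (i.*2%:Z + 1, j.*2%:Z).
  move=> hi hj hh; rewrite /K' /rect /=; apply/andP; split; last by lia.
  apply/negP => cz; have Kz : K (i.*2%:Z + 1, j.*2%:Z) by rewrite /K /rect /= cz /=; lia.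
  have a1 : Z2_adj (i.*2%:Z, j.*2%:Z) (i.*2%:Z + 1, j.*2%:Z) by rewrite /Z2_adj /=; lia.
  have a2 : Z2_adj (i.+1.*2%:Z, j.*2%:Z) (i.*2%:Z + 1, j.*2%:Z) by rewrite /Z2_adj /=; lia.
  suff : s i j = s i.+1 j by move: hh; rewrite /h => + e; rewrite e addbb.
  apply/idP/idP => e.
    by apply: (SS (i.*2%:Z + 1, j.*2%:Z)); [exact: SS a1|apply: vK|rewrite Z2_adjC].
  by apply: (SS (i.*2%:Z + 1, j.*2%:Z)); [exact: SS a2|apply: vK; lia|rewrite Z2_adjC].
have vK' i j : (0 < i)%N -> (i < n)%N -> (j < m)%N -> v i j -> K' (i.*2%:Z, j.*2%:Z + 1).
  move=> i0 hi hj hv; rewrite /K' /rect /=; apply/andP; split; last by lia.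
  apply/negP => cz; have Kz : K (i.*2%:Z, j.*2%:Z + 1) by rewrite /K /rect /= cz /=; lia.
  have a1 : Z2_adj (i.*2%:Z, j.*2%:Z) (i.*2%:Z, j.*2%:Z + 1) by rewrite /Z2_adj /=; lia.
  have a2 : Z2_adj (i.*2%:Z, j.+1.*2%:Z) (i.*2%:Z, j.*2%:Z + 1) by rewrite /Z2_adj /=; lia.
  suff : s i j = s i j.+1 by move: hv; rewrite /v => + e; rewrite e addbb.
  apply/idP/idP => e.
    by apply: (SS (i.*2%:Z, j.*2%:Z + 1)); [exact: SS a1|apply: vK; lia|rewrite Z2_adjC].
  by apply: (SS (i.*2%:Z, j.*2%:Z + 1)); [exact: SS a2|apply: vK; lia|rewrite Z2_adjC].
have th i j : (i < n)%N -> (j.+1 < m)%N -> h i j.+1 -> t i j = t i j.+1.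
  move=> hi hj hh; have Km := hK _ _ hi (ltnW hj) hh.
  have a1 : Z2_adj (i.*2%:Z + 1, j.*2%:Z + 1) (i.*2%:Z + 1, j.+1.*2%:Z) by rewrite /Z2_adj /=; lia.
  have a2 : Z2_adj (i.*2%:Z + 1, j.+1.*2%:Z + 1) (i.*2%:Z + 1, j.+1.*2%:Z) by rewrite /Z2_adj /=; lia.
  apply/idP/idP => e.
    by apply: (TT (i.*2%:Z + 1, j.+1.*2%:Z)); [exact: TT a1|apply: fK; lia|rewrite Z2_adjC].
  by apply: (TT (i.*2%:Z + 1, j.+1.*2%:Z)); [exact: TT a2|apply: fK; lia|rewrite Z2_adjC].
have tv i j : (i.+1 < n)%N -> (j < m)%N -> v i.+1 j -> t i j = t i.+1 j.
  move=> hi hj hv; have Km := vK' i.+1 j isT hi hj hv.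
  have a1 : Z2_adj (i.*2%:Z + 1, j.*2%:Z + 1) (i.+1.*2%:Z, j.*2%:Z + 1) by rewrite /Z2_adj /=; lia.
  have a2 : Z2_adj (i.+1.*2%:Z + 1, j.*2%:Z + 1) (i.+1.*2%:Z, j.*2%:Z + 1) by rewrite /Z2_adj /=; lia.
  apply/idP/idP => e.
    by apply: (TT (i.+1.*2%:Z, j.*2%:Z + 1)); [exact: TT a1|apply: fK; lia|rewrite Z2_adjC].
  by apply: (TT (i.+1.*2%:Z, j.*2%:Z + 1)); [exact: TT a2|apply: fK; lia|rewrite Z2_adjC].
have t0 i : (i < n)%N -> h i 0%N -> t i 0%N.
  move=> hi hh; have Km := hK _ _ hi (leq0n m) hh.
  apply: (TT (i.*2%:Z + 1, 0%N.*2%:Z)); [|exact: fK|by rewrite /Z2_adj /=; lia].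
  by apply/asboolP; exists (i.*2%:Z + 1, 0%N.*2%:Z); split=> //; apply: conn_refl.
pose A j := \big[addb/false]_(0 <= i < n) (t i j && h i j).
pose B j := \big[addb/false]_(0 <= i < n) (t i j && h i j.+1).
(* The boundary of [S] has an even number of edges around each face, and vertical ones separate
   faces with equal [t], so the sum along the row telescopes. The end terms vanish, as [s] is
   constant on the left and on the right side. *)
have AB j : (j < m)%N -> A j = B j.
  move=> hj; suff : A j (+) B j = false by case: (A j); case: (B j).
  pose w i := [&& (i < n)%N, t i j & v i j].
  rewrite -big_split /=.
  transitivity (\big[addb/false]_(0 <= i < n) (w i (+) w i.+1)).
    apply: eq_big_nat => i /andP[_ hi]; rewrite -andb_addr.
    have -> : h i j (+) h i j.+1 = v i j (+) v i.+1 j.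
      by rewrite /h /v; case: (s i j); case: (s i.+1 j); case: (s i j.+1); case: (s _ _).
    rewrite andb_addr {1}/w hi /=; congr addb.
    rewrite /w; have [hi'|hi'] := ltnP i.+1 n.
      by case E : (v i.+1 j); rewrite ?andbF // tv.
    have e : i.+1 = n by lia.
    by rewrite e /v !sn /= andbF.
  rewrite big_addb_telescope /w ltnn /= addbF /v !s0 //; last by lia.
  by rewrite !andbF.
have BA j : (j.+1 < m)%N -> B j = A j.+1.
  move=> hj; apply: eq_big_nat => i /andP[_ hi].
  by case E : (h i j.+1); rewrite ?andbF // th.
(* On the bottom row [t] holds beside every boundary edge, so this counts the changes of [s], from
   true at the left to false at the right. *)
have A0 : A 0%N.
  have -> : A 0%N = \big[addb/false]_(0 <= i < n) (s i 0%N (+) s i.+1 0%N).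
    apply: eq_big_nat => i /andP[_ hi]; rewrite -/(h i 0%N).
    by case E : (h i 0%N); rewrite ?andbF // t0.
  by rewrite big_addb_telescope s0 // sn.
have Aj j : (j < m)%N -> A j.
  by elim: j => // j IH hj; rewrite -BA // -AB; [apply: IH; lia|lia].
have hm : (m.-1 < m)%N by lia.
have := Aj _ hm; rewrite AB // => /big_addb_true[i hi /andP[ti hh]].
rewrite prednK // in hh.
have Km := hK _ _ hi (leqnn m) hh.
have : T (i.*2%:Z + 1, m.*2%:Z).
  by apply: TT ti Km _; rewrite /Z2_adj /=; lia.
by move=> /asboolP[x [x0 cx]]; exists x, (i.*2%:Z + 1, m.*2%:Z).
Qed.

(** * Russo-Seymour-Welsh estimates *)

Definition rect_seq (a b c d : int) : seq Z2 :=
  [seq (a + i%:Z, c + j%:Z) | i <- iota 0 `|b - a|.+1, j <- iota 0 `|d - c|.+1].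

Lemma rect_seqP a b c d z : rect a b c d z -> z \in rect_seq a b c d.
Proof.
move=> hz; apply/allpairsP; exists (`|(z.1 - a)|%N, `|(z.2 - c)|%N).
move: hz; rewrite /rect !mem_iota /=; case: z => z1 z2 /= hz.
by split; [lia|lia|apply/eqP; rewrite -pair_eqE /=; lia].
Qed.

Definition linked (D P Q : pred Z2) (c : coloring) : Prop :=
  exists x y, [/\ P x, Q y & conn (fun z => c z && D z) x y].

Lemma linked_supported s (D P Q : pred Z2) :
  (forall z, D z -> z \in s) -> supported s (linked D P Q).
Proof.
move=> Ds c c' cc' [x [y [Px Qy h]]]; exists x, y; split=> //.
by apply: conn_sub h => z /andP[cz Dz]; rewrite -cc' ?cz //; apply: Ds.
Qed.

Lemma linked_increasing D P Q : increasing (linked D P Q).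
Proof.
move=> c c' cc' [x [y [Px Qy h]]]; exists x, y; split=> //.
by apply: conn_sub h => z /andP[/cc' -> ->].
Qed.

Definition finite_region (D : pred Z2) := exists s : seq Z2, forall z, D z -> z \in s.

Lemma bounded_rect a b c d : finite_region (rect a b c d).
Proof. by exists (rect_seq a b c d) => z; apply: rect_seqP. Qed.

Lemma linked_local D P Q : finite_region D -> local (linked D P Q).
Proof. by move=> [s Ds]; exists s; apply: linked_supported. Qed.

Section RSW.
Variable R : realFieldType.

(** Bundles with a lower bound what Harris' inequality requires, so that bounds multiply under
    conjunction. *)
Definition likely (p : R) (A : coloring -> Prop) :=
  [/\ local A, increasing A, 0 <= p & p <= Pr R A].

Lemma likely_and p q A B : likely p A -> likely q B ->
  likely (p * q) (fun c => A c /\ B c).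
Proof.
move=> [lA iA p0 pA] [lB iB q0 qB]; split.
- exact: local_and.
- exact: increasing_and.
- exact: mulr_ge0.
- by apply: le_trans (Pr_FKG R lA lB iA iB); apply: ler_pM.
Qed.

Lemma likely_sub p A B : likely p A -> local B -> increasing B ->
  (forall c, proper_coloring c -> A c -> B c) -> likely p B.
Proof.
move=> [lA iA p0 pA] lB iB AB; split=> //; apply: le_trans pA _.
exact: Pr_mono.
Qed.

Lemma likely_linked p A D P Q : likely p A -> finite_region D ->
  (forall c, proper_coloring c -> A c -> linked D P Q c) -> likely p (linked D P Q).
Proof.
by move=> pA bD; apply: likely_sub pA _ _; [apply: linked_local|apply: linked_increasing].
Qed.

(** Symmetries that preserve the law of the coloring; vertices and faces being kept apart,
    translations must be by even vectors. *)
Definition lattice_map (g : Z2 -> Z2) :=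
  [/\ injective g, (forall u v, Z2_adj u v -> Z2_adj (g u) (g v)),
      (forall z, is_vertex (g z) = is_vertex z) &
      (forall z, is_face (g z) = is_face z)].

Lemma likely_map g p (D P Q D' P' Q' : pred Z2) : lattice_map g -> finite_region D' ->
  (forall z, D z -> D' (g z)) -> (forall z, D z -> P z -> P' (g z)) ->
  (forall z, D z -> Q z -> Q' (g z)) ->
  likely p (linked D P Q) -> likely p (linked D' P' Q').
Proof.
move=> [ig ag vg fg] bD' DD' PP' QQ' [lA iA p0 pA].
have lA' := linked_local P' Q' bD'.
split=> //; first exact: linked_increasing.
apply: le_trans pA _; rewrite -(Pr_map R lA ig vg fg); apply: Pr_mono => //.
  exact: local_map.
move=> c _ [x [y [Px Qy h]]]; exists (g x), (g y).
have /andP[_ Dx] := conn_meml h; have /andP[_ Dy] := conn_memr h.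
split; [exact: PP'|exact: QQ'|].
by apply: conn_map h => // z /andP[/= -> /DD'].
Qed.

Definition translation (a b : int) (z : Z2) : Z2 := (z.1 + a, z.2 + b).
Definition flip1 (z : Z2) : Z2 := (- z.1, z.2).
Definition flip2 (z : Z2) : Z2 := (z.1, - z.2).
Definition swap_coords (z : Z2) : Z2 := (z.2, z.1).

Lemma translation_lattice_map a b : (a %% 2)%Z = 0 -> (b %% 2)%Z = 0 ->
  lattice_map (translation a b).
Proof.
move=> ha hb; split.
- by move=> [x1 x2] [y1 y2] [/addIr -> /addIr ->].
- by move=> u v; rewrite /Z2_adj /translation /=; lia.
- by move=> z; rewrite /is_vertex /translation /=; lia.
- by move=> z; rewrite /is_face /translation /=; lia.
Qed.

Lemma flip1_lattice_map : lattice_map flip1.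
Proof.
split.
- by move=> [x1 x2] [y1 y2] [/oppr_inj -> ->].
- by move=> u v; rewrite /Z2_adj /flip1 /=; lia.
- by move=> z; rewrite /is_vertex /flip1 /=; lia.
- by move=> z; rewrite /is_face /flip1 /=; lia.
Qed.

Lemma flip2_lattice_map : lattice_map flip2.
Proof.
split.
- by move=> [x1 x2] [y1 y2] [-> /oppr_inj ->].
- by move=> u v; rewrite /Z2_adj /flip2 /=; lia.
- by move=> z; rewrite /is_vertex /flip2 /=; lia.
- by move=> z; rewrite /is_face /flip2 /=; lia.
Qed.

Lemma swap_lattice_map : lattice_map swap_coords.
Proof.
split.
- by move=> [x1 x2] [y1 y2] [-> ->].
- by move=> u v; rewrite /Z2_adj /swap_coords /=; lia.
- by move=> z; rewrite /is_vertex /swap_coords /=; lia.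
- by move=> z; rewrite /is_face /swap_coords /=; lia.
Qed.

Definition crossing1 (a b c d : int) : coloring -> Prop :=
  linked (rect a b c d) (fun z => z.1 == a) (fun z => z.1 == b).
Definition crossing2 (a b c d : int) : coloring -> Prop :=
  linked (rect a b c d) (fun z => z.2 == c) (fun z => z.2 == d).

Lemma lipschitz1_fst : lipschitz1 (fun z => z.1).
Proof. by move=> u v; rewrite /Z2_adj; lia. Qed.

Lemma lipschitz1_snd : lipschitz1 (fun z => z.2).
Proof. by move=> u v; rewrite /Z2_adj; lia. Qed.

(** Self-duality: without an open crossing there is a closed one in the other direction, and the
    dual of that event implies an open crossing. Hence [1 - Pr A <= Pr A]. *)
Lemma square_crossing (n : nat) (a b : int) : (0 < n)%N ->
  (a %% 2)%Z = 0 -> (b %% 2)%Z = 0 ->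
  likely 2^-1 (crossing1 a (a + n.*2%:Z) b (b + n.*2%:Z)).
Proof.
move=> n0 ha hb.
apply: (likely_map (translation_lattice_map ha hb)
  (D := rect 0 n.*2%:Z 0 n.*2%:Z)
  (P := fun z => z.1 == 0) (Q := fun z => z.1 == n.*2%:Z)).
- exact: bounded_rect.
- by move=> z; rewrite /rect /translation /=; lia.
- by move=> z _; rewrite /translation /=; lia.
- by move=> z _; rewrite /translation /=; lia.
set A := linked _ _ _.
have lA : local A by apply/linked_local/bounded_rect.
split; [exact: lA|exact: linked_increasing|by rewrite invr_ge0|].
(* The image under the map [h] below of the rectangle of closed crossings in
   [open_or_closed_crossing]. *)
pose B := linked (rect 1 (n.*2%:Z + 1) 0 (n.*2%:Z - 2))
  (fun z => z.1 == 1) (fun z => z.1 == n.*2%:Z + 1).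
have lB : local B by apply/linked_local/bounded_rect.
have BA c : proper_coloring c -> B c -> A c.
  (* The point [x] is open in an odd column, hence not a face, so its left neighbour [x0] is a
     vertex and open: the path is prolonged by it, then cut at the column [n.*2]. *)
  move=> pc [x [y [/eqP x1 /eqP y1 h]]].
  have /andP[cx rx] := conn_meml h.
  pose x0 : Z2 := (0, x.2).
  have cx0 : c x0.
    apply: (pc x0).1; have := (pc x).2; rewrite cx /is_vertex /is_face x1 /=.
    by case: eqP => //= _ /(_ isT).
  pose K : pred Z2 := fun z => c z && rect 0 (n.*2%:Z + 1) 0 n.*2%:Z z.
  have h' : conn K x0 y.
    apply: (@conn_trans _ _ x); last first.
      by apply: conn_sub h => z /andP[cz]; rewrite /K cz /rect; lia.
    apply: conn_step; rewrite /K ?cx ?cx0 /=; move: rx; rewrite /rect /Z2_adj /=; lia.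
  have [|||x' [y' [x'1 y'1 h'']]] :=
    conn_crossing lipschitz1_fst h' (a := 0) (b := n.*2%:Z) => //.
    by rewrite y1 lerDl.
  exists x', y'; split; [exact/eqP|exact/eqP|apply: conn_sub h''] => z.
  by rewrite /K => /andP[/andP[->]]; rewrite /rect /=; lia.
pose h (z : Z2) : Z2 := (z.2 + 1, z.1 - 1).
have ih : injective h by move=> [x1 x2] [y1 y2] [/addIr -> /addIr ->].
have vh z : is_vertex (h z) = is_face z by rewrite /is_vertex /is_face /=; lia.
have fh z : is_face (h z) = is_vertex z by rewrite /is_vertex /is_face /=; lia.
have lBh : local (fun c => B (fun z => ~~ c (h z))).
  exact: (@local_map h (fun c => B (fun z => ~~ c z)) (local_neg lB)).
have : Pr R (fun c => ~ A c) <= Pr R A.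
  apply: le_trans (Pr_mono R lB lA BA).
  rewrite -(Pr_dual R lB ih vh fh).
  apply: Pr_mono => //; first exact: local_not.
  move=> c pc nA; case: (open_or_closed_crossing pc n0 n0) => [[x [y [/eqP ? /eqP ? ?]]]|].
    by case: nA; exists x, y.
  move=> [x [y [x2 y2 hxy]]].
  exists (h x), (h y); split; rewrite /= ?x2 ?y2 //.
  apply: conn_map hxy; first by move=> u v; rewrite /Z2_adj /=; lia.
  move=> [z1 z2] /andP[cz]; rewrite /h /rect /= !subrK addrK cz /=; lia.
rewrite Pr_not //; lra.
Qed.

End RSW.

(** [crossings_meet] for the components of [x] and [u], so that the meeting point is joined to
    both. *)
Lemma crossings_linked (K K' : pred Z2) a b c d x y u v :
  (forall z, K z -> rect a b c d z) -> (forall z, K' z -> rect a b c d z) ->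
  conn K x y -> x.1 = a -> y.1 = b -> conn K' u v -> u.2 = c -> v.2 = d ->
  exists2 z, conn K x z & conn K' u z.
Proof.
move=> Kr Kr' cxy xa yb cuv uc vd.
have Kr1 z : `[< conn K x z >] -> rect a b c d z by move=> /asboolP/conn_memr/Kr.
have Kr2 z : `[< conn K' u z >] -> rect a b c d z by move=> /asboolP/conn_memr/Kr'.
have [z /andP[/asboolP h1 /asboolP h2]] := crossings_meet Kr1 Kr2 (conn_component cxy) xa yb (conn_component cuv) uc vd.
by exists z.
Qed.

Lemma gap_crossings_linked (K K' : pred Z2) a b c d x y u v :
  (forall z, K z -> rect a b c d z) -> (forall z, K' z -> rect a b c d z) ->
  conn K x y -> x.1 = a -> y.1 = b -> conn K' u v -> u.1 = b -> v.1 = b ->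
  u.2 <= y.2 <= v.2 -> exists2 z, conn K x z & conn K' u z.
Proof.
move=> Kr Kr' cxy xa yb cuv ub vb uyv.
have Kr1 z : `[< conn K x z >] -> rect a b c d z by move=> /asboolP/conn_memr/Kr.
have Kr2 z : `[< conn K' u z >] -> rect a b c d z by move=> /asboolP/conn_memr/Kr'.
have [z /andP[/asboolP h1 /asboolP h2]] := gap_crossings_meet Kr1 Kr2 (conn_component cxy) xa yb (conn_component cuv) ub vb uyv.
by exists z.
Qed.

Lemma flip1K : involutive flip1.
Proof. by move=> [z1 z2]; rewrite /flip1 /= opprK. Qed.

Lemma conn_flip1 (K : pred Z2) x y : conn K x y ->
  conn (fun z => K (flip1 z)) (flip1 x) (flip1 y).
Proof.
apply: conn_map; first by have [_ ag _ _] := flip1_lattice_map.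
by move=> z; rewrite flip1K.
Qed.

Lemma gap_crossings_linked_left (K K' : pred Z2) a b c d x y u v :
  (forall z, K z -> rect a b c d z) -> (forall z, K' z -> rect a b c d z) ->
  conn K x y -> x.1 = b -> y.1 = a -> conn K' u v -> u.1 = a -> v.1 = a ->
  u.2 <= y.2 <= v.2 -> exists2 z, conn K x z & conn K' u z.
Proof.
move=> Kr Kr' cxy xb ya cuv ua va uyv.
have e1 : (flip1 x).1 = - b by rewrite /= xb.
have e2 : (flip1 y).1 = - a by rewrite /= ya.
have e3 : (flip1 u).1 = - a by rewrite /= ua.
have e4 : (flip1 v).1 = - a by rewrite /= va.
have [||z h1 h2] := gap_crossings_linked (c := c) (d := d) _ _
  (conn_flip1 cxy) e1 e2 (conn_flip1 cuv) e3 e4 uyv.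
- by move=> z /Kr; rewrite /rect /=; lia.
- by move=> z /Kr'; rewrite /rect /=; lia.
exists (flip1 z).
  have := conn_flip1 h1; rewrite flip1K; apply: conn_sub => w; by rewrite flip1K.
have := conn_flip1 h2; rewrite flip1K; apply: conn_sub => w; by rewrite flip1K.
Qed.

Section RSW.
Variable R : realFieldType.

(* Two crossings in the long direction overlapping on a square are joined by a
   crossing of this square in the other direction. *)
Lemma glue_crossings (p q : R) (H a b : nat) : ~~ odd H -> ~~ odd a -> (0 < H)%N ->
  likely p (crossing1 0 (H + a)%:Z 0 H%:Z) ->
  likely q (crossing1 0 (H + b)%:Z 0 H%:Z) ->
  likely (p * (q * 2^-1)) (crossing1 0 (H + (a + b))%:Z 0 H%:Z).
Proof.
move=> He ae H0 hp hq.
have {}hq : likely q (crossing1 a%:Z (H + (a + b))%:Z 0 H%:Z).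
  apply: (likely_map (translation_lattice_map (a := a%:Z) (b := 0) _ _)) hq; first lia.
  - by [].
  - exact: bounded_rect.
  - by move=> z; rewrite /rect /translation /=; lia.
  - by move=> z _; rewrite /translation /=; lia.
  - by move=> z _; rewrite /translation /=; lia.
have h2 : likely (2^-1 : R) (crossing2 a%:Z (H + a)%:Z 0 H%:Z).
  have H'0 : (0 < H./2)%N by lia.
  have ea : (a%:Z %% 2)%Z = 0 by lia.
  apply: (likely_map swap_lattice_map) (square_crossing R H'0 (erefl : (0 %% 2)%Z = 0) ea).
  - exact: bounded_rect.
  - by move=> z; rewrite /rect /swap_coords /=; lia.
  - by move=> z _; rewrite /swap_coords /=; lia.
  - by move=> z _; rewrite /swap_coords /=; lia.
apply: likely_linked (likely_and hp (likely_and hq h2)) _ _; first exact: bounded_rect.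
move=> c pc [[x [y [/eqP x1 /eqP y1 cxy]]] [[x' [y' [/eqP x'1 /eqP y'1 cxy']]]]].
move=> [u [v [/eqP u2 /eqP v2 cuv]]].
have [||z h1 h2'] := crossings_linked (a := 0) (b := (H + a)%:Z) (c := 0) (d := H%:Z)
  _ _ cxy x1 y1 cuv u2 v2.
- by move=> z /andP[].
- by move=> z /andP[_]; rewrite /rect; lia.
have [||z' h1' h2''] := crossings_linked (a := a%:Z) (b := (H + (a + b))%:Z) (c := 0) (d := H%:Z)
  _ _ cxy' x'1 y'1 cuv u2 v2.
- by move=> w /andP[].
- by move=> w /andP[_]; rewrite /rect; lia.
exists x, y'; split; [exact/eqP|exact/eqP|].
pose K : pred Z2 := fun z => c z && rect 0 (H + (a + b))%:Z 0 H%:Z z.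
have K1 : forall w, c w && rect 0 (H + a)%:Z 0 H%:Z w -> K w.
  by move=> w /andP[cw]; rewrite /K cw /rect; lia.
have K2 : forall w, c w && rect a%:Z (H + (a + b))%:Z 0 H%:Z w -> K w.
  by move=> w /andP[cw]; rewrite /K cw /rect; lia.
have K3 : forall w, c w && rect a%:Z (H + a)%:Z 0 H%:Z w -> K w.
  by move=> w /andP[cw]; rewrite /K cw /rect; lia.
apply: (conn_trans (conn_sub K1 h1)).
apply: (conn_trans (conn_sym (conn_sub K3 h2'))).
apply: (conn_trans (conn_sub K3 h2'')).
apply: (conn_trans (conn_sym (conn_sub K2 h1'))).
exact: conn_sub cxy'.
Qed.

(** Each gluing adds [a] to the length and costs a factor [p / 2]. *)
Lemma long_crossings (p : R) (H a : nat) : ~~ odd H -> ~~ odd a -> (0 < H)%N ->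
  likely p (crossing1 0 (H + a)%:Z 0 H%:Z) ->
  forall k, likely (p * (p * 2^-1) ^+ k) (crossing1 0 (H + a * k.+1)%:Z 0 H%:Z).
Proof.
move=> He ae H0 hp; elim=> [|k IH]; first by rewrite expr0 mulr1 muln1.
have -> : p * (p * 2^-1) ^+ k.+1 = p * (p * (p * 2^-1) ^+ k * 2^-1) by rewrite exprS; ring.
by rewrite [(a * k.+2)%N]mulnS; apply: glue_crossings.
Qed.

(** * Tassion's gluing in boxes *)

Definition box (n : nat) : pred Z2 := rect (- n%:Z) n%:Z (- n%:Z) n%:Z.

Definition to_right (n : nat) (a b : int) : coloring -> Prop :=
  linked (box n) (fun z => z.1 == - n%:Z) (fun z => (z.1 == n%:Z) && (a <= z.2 <= b)).

Lemma box_crossing (n : nat) : ~~ odd n -> (0 < n)%N ->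
  likely (2^-1 : R) (crossing1 (- n%:Z) n%:Z (- n%:Z) n%:Z).
Proof.
move=> ne n0.
have := @square_crossing R n (- n%:Z) (- n%:Z) n0.
have -> : - n%:Z + n.*2%:Z = n%:Z by lia.
by apply; lia.
Qed.

(** A crossing of the box ends in the upper or in the lower half of the right side, and these events
    are exchanged by a reflection. *)
Lemma to_right_half (n : nat) : ~~ odd n -> (0 < n)%N ->
  4^-1 <= Pr R (to_right n 0 n%:Z).
Proof.
move=> ne n0; have [_ _ _ h] := box_crossing ne n0.
pose A := to_right n 0 n%:Z; pose B := to_right n (- n%:Z) 0.
have bB : finite_region (box n) by exact: bounded_rect.
have lA : local A by apply: linked_local.
have lB : local B by apply: linked_local.
have BA : Pr R B <= Pr R A.
  suff [] : likely (Pr R B) A by [].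
  apply: (likely_map flip2_lattice_map (D := box n) (P := fun z => z.1 == - n%:Z)
    (Q := fun z => (z.1 == n%:Z) && (- n%:Z <= z.2 <= 0))) => //.
  - by move=> z; rewrite /box /rect /flip2 /=; lia.
  - by move=> z _; rewrite /flip2 /=; lia.
  - by split=> //; [exact: linked_increasing|exact: Pr_ge0].
have : Pr R (crossing1 (- n%:Z) n%:Z (- n%:Z) n%:Z) <= Pr R (fun c => A c \/ B c).
  apply: Pr_mono; [by apply: linked_local|exact: local_or|].
  move=> c _ [x [y [x1 y1 h']]].
  have /andP[_] := conn_memr h'; rewrite /rect => ry.
  have [y2|y2] := leP 0 y.2; [left|right]; exists x, y; split=> //; lia.
have := Pr_or R lA lB; lra.
Qed.

(* The height [al] balances the probabilities of reaching the upper part and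
   the middle part of the right side. *)
Lemma balance_height (n : nat) : ~~ odd n -> (0 < n)%N ->
  exists al : nat, [/\ (al <= n)%N, likely (8^-1 : R) (to_right n al%:Z n%:Z) &
    likely (8^-1 : R) (to_right n 0 al%:Z)].
Proof.
move=> ne n0.
have bB : finite_region (box n) by exact: bounded_rect.
(* 1/8 is half of the bound 1/4 of [to_right_half]. For the largest such height, the part from
   [al + 1] on has probability less than 1/8, which leaves at least 1/8 for the part up to [al]. *)
pose P k := (k <= n)%N && (8^-1 <= Pr R (to_right n k%:Z n%:Z)).
have ex : exists k, P k.
  by exists 0%N; rewrite /P leq0n /=; apply: le_trans (to_right_half ne n0); lra.
have ub k : P k -> (k <= n)%N by case/andP.
case: (ex_maxnP ex ub) => al /andP[aln Pal] alm.
exists al; split=> //.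
  by split; [exact: linked_local|exact: linked_increasing|rewrite invr_ge0|].
split; [exact: linked_local|exact: linked_increasing|by rewrite invr_ge0|].
have := to_right_half ne n0.
move: aln; rewrite leq_eqVlt => /orP[/eqP ->|aln]; first lra.
have : ~~ P al.+1 by apply/negP => /alm; lia.
rewrite /P aln /= -ltNge => h1.
have : Pr R (to_right n 0 n%:Z) <=
    Pr R (fun c => to_right n 0 al%:Z c \/ to_right n al.+1%:Z n%:Z c).
  apply: Pr_mono; [exact: linked_local|by apply: local_or; exact: linked_local|].
  move=> c _ [x [y [x1 y1 h']]].
  by have [y2|y2] := leP y.2 al%:Z; [left|right]; exists x, y; split=> //; lia.
have lA : local (to_right n 0 al%:Z) by exact: linked_local.
have lB : local (to_right n al.+1%:Z n%:Z) by exact: linked_local.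
have := Pr_or R lA lB; lra.
Qed.
End RSW.

Section RSW2.
Variable R : realFieldType.

Definition from_right (n : nat) (a b : int) : coloring -> Prop :=
  linked (box n) (fun z => z.1 == n%:Z) (fun z => (z.1 == - n%:Z) && (a <= z.2 <= b)).

Lemma likely_from_right (p : R) n a b : likely p (to_right n a b) ->
  likely p (from_right n a b).
Proof.
apply: (likely_map flip1_lattice_map); first exact: bounded_rect.
- by move=> z; rewrite /box /rect /flip1 /=; lia.
- by move=> z _; rewrite /flip1 /=; lia.
- by move=> z _; rewrite /flip1 /=; lia.
Qed.

Lemma likely_to_right_down (p : R) n (a b : int) : likely p (to_right n a b) ->
  likely p (to_right n (- b) (- a)).
Proof.
apply: (likely_map flip2_lattice_map); first exact: bounded_rect.
- by move=> z; rewrite /box /rect /flip2 /=; lia.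
- by move=> z _; rewrite /flip2 /=; lia.
- by move=> z _; rewrite /flip2 /=; lia.
Qed.

(* Tassion's gluing. In the small box [box m], four paths ending in the corners and
   a vertical crossing form an X-shaped cluster; the two paths of the larger boxes
   end in the gaps between its arms, hence meet it. *)
Lemma x_cluster_gluing (m n al be : nat) (y0 : int) :
  ~~ odd m -> ~~ odd n -> (0 < m)%N -> (m <= n)%N -> (n <= 2 * m)%N -> (al <= m)%N ->
  (y0 %% 2)%Z = 0 -> y0 <= 0 -> - al%:Z <= y0 -> y0 + be%:Z <= al%:Z ->
  likely (8^-1 : R) (to_right m al%:Z m%:Z) ->
  likely (8^-1 : R) (to_right n 0 be%:Z) ->
  likely (2^-1 * 8^-1 ^+ 6 : R)
    (crossing1 0 (4 * n - 2 * m)%:Z 0 (n + 2 * m)%:Z).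
Proof.
move=> me ne m0 mn nm alm y0e y00 y01 y02 hup hmid.
(* The box of size [n] is shifted by [(m - n, y0)], so that its right side lies along that of
   [box m] and its target heights fall between [- al] and [al]; its mirror image is used on the
   left. These are the sides of a rectangle containing all three boxes. *)
pose a : int := m%:Z - 2 * n%:Z; pose b : int := 2 * n%:Z - m%:Z.
pose c0 : int := y0 - n%:Z; pose d : int := y0 + 2 * m%:Z.
suff : likely (2^-1 * 8^-1 ^+ 6 : R) (crossing1 a b c0 d).
  have ha : ((- a) %% 2)%Z = 0 by rewrite /a; lia.
  have hc : ((- c0) %% 2)%Z = 0 by rewrite /c0; lia.
  apply: (likely_map (translation_lattice_map ha hc)); first exact: bounded_rect.
  - by move=> z; rewrite /rect /translation /a /b /c0 /d /=; lia.
  - by move=> z _; rewrite /translation /a /=; lia.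
  - by move=> z _; rewrite /translation /a /b /=; lia.
have hdown := likely_to_right_down hup.
have hup' := likely_from_right hup.
have hdown' := likely_from_right hdown.
have hvert : likely (2^-1 : R) (crossing2 (- m%:Z) m%:Z (- m%:Z) m%:Z).
  apply: (likely_map swap_lattice_map) (box_crossing R me m0); first exact: bounded_rect.
  - by move=> z; rewrite /rect /swap_coords /=; lia.
  - by move=> z _; rewrite /swap_coords /=; lia.
  - by move=> z _; rewrite /swap_coords /=; lia.
have hmid1 : likely (8^-1 : R) (linked (rect a m%:Z c0 (y0 + n%:Z))
    (fun z => z.1 == a) (fun z => (z.1 == m%:Z) && (y0 <= z.2 <= y0 + be%:Z))).
  have hx : ((m%:Z - n%:Z) %% 2)%Z = 0 by lia.
  apply: (likely_map (translation_lattice_map hx y0e)) hmid; first exact: bounded_rect.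
  - by move=> z; rewrite /box /rect /translation /a /c0 /=; lia.
  - by move=> z _; rewrite /translation /a /=; lia.
  - by move=> z _; rewrite /translation /=; lia.
have hmid2 : likely (8^-1 : R) (linked (rect (- m%:Z) b c0 (y0 + n%:Z))
    (fun z => z.1 == b) (fun z => (z.1 == - m%:Z) && (y0 <= z.2 <= y0 + be%:Z))).
  apply: (likely_map flip1_lattice_map) hmid1; first exact: bounded_rect.
  - by move=> z; rewrite /rect /flip1 /a /b /=; lia.
  - by move=> z _; rewrite /flip1 /a /b /=; lia.
  - by move=> z _; rewrite /flip1 /=; lia.
have all := likely_and hvert (likely_and hup (likely_and hdown (likely_and hup'
  (likely_and hdown' (likely_and hmid1 hmid2))))).
(* One vertical crossing, four paths to the corners, two paths of the larger boxes. *)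
have -> : 2^-1 * 8^-1 ^+ 6 = 2^-1 * (8^-1 * (8^-1 * (8^-1 * (8^-1 * (8^-1 * 8^-1))))) :> R.
  by rewrite !exprS expr0; field.
apply: likely_linked all _ _; first exact: bounded_rect.
move=> c pc [[p [q [/eqP p2 /eqP q2 cpq]]]].
move=> [[x1 [u1 [/eqP x11 /andP[/eqP u11 u12] c1]]]].
move=> [[x2 [u2 [/eqP x21 /andP[/eqP u21 u22] c2]]]].
move=> [[x3 [u3 [/eqP x31 /andP[/eqP u31 u32] c3]]]].
move=> [[x4 [u4 [/eqP x41 /andP[/eqP u41 u42] c4]]]].
move=> [[x5 [u5 [/eqP x51 /andP[/eqP u51 u52] c5]]]].
move=> [x6 [u6 [/eqP x61 /andP[/eqP u61 u62] c6]]].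
pose Kb : pred Z2 := fun z => c z && box m z.
have Kbr z : Kb z -> rect (- m%:Z) m%:Z (- m%:Z) m%:Z z by case/andP.
have LRp x y : conn Kb x y -> x.1 = - m%:Z -> y.1 = m%:Z -> conn Kb p x.
  move=> cxy xm ym.
  have [z h1 h2] := crossings_linked Kbr Kbr cxy xm ym cpq p2 q2.
  by apply: (conn_trans h2); apply: conn_sym.
have pu1 : conn Kb p u1 by apply: (conn_trans (LRp _ _ c1 x11 u11)).
have pu2 : conn Kb p u2 by apply: (conn_trans (LRp _ _ c2 x21 u21)).
have pu3 : conn Kb p u3 by apply: LRp (conn_sym c3) u31 x31.
have pu4 : conn Kb p u4 by apply: LRp (conn_sym c4) u41 x41.
(* The two right arms end at heights at most [- al] and at least [al], hence on either side of [u5];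
   likewise on the left for [u6]. *)
have u21' : conn Kb u2 u1 by apply: conn_trans (conn_sym pu2) pu1.
have u43' : conn Kb u4 u3 by apply: conn_trans (conn_sym pu4) pu3.
have [|||z1 h1 h1'] := gap_crossings_linked (a := a) (b := m%:Z) (c := c0) (d := d)
  _ _ c5 x51 u51 u21' u21 u11 _.
- by move=> z /andP[_]; rewrite /rect /d; lia.
- by move=> z /Kbr; rewrite /rect /a /c0 /d; lia.
- by lia.
have [|||z2 h2 h2'] := gap_crossings_linked_left (a := - m%:Z) (b := b) (c := c0) (d := d)
  _ _ c6 x61 u61 u43' u41 u31 _.
- by move=> z /andP[_]; rewrite /rect /d; lia.
- by move=> z /Kbr; rewrite /rect /b /c0 /d; lia.
- by lia.
exists x5, x6; split; [exact/eqP|exact/eqP|].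
pose K : pred Z2 := fun z => c z && rect a b c0 d z.
have s1 : forall z, Kb z -> K z.
  by move=> z /andP[cz]; rewrite /K cz /box /rect /a /b /c0 /d; lia.
have s2 : forall z, c z && rect a m%:Z c0 (y0 + n%:Z) z -> K z.
  by move=> z /andP[cz]; rewrite /K cz /rect /a /b /c0 /d; lia.
have s3 : forall z, c z && rect (- m%:Z) b c0 (y0 + n%:Z) z -> K z.
  by move=> z /andP[cz]; rewrite /K cz /rect /a /b /c0 /d; lia.
apply: (conn_trans (conn_sub s2 h1)).
apply: (conn_trans (conn_sym (conn_sub s1 h1'))).
apply: (conn_trans (conn_sym (conn_sub s1 pu2))).
apply: (conn_trans (conn_sub s1 pu4)).
apply: (conn_trans (conn_sub s1 h2')).
exact: (conn_sym (conn_sub s3 h2)).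
Qed.

(* Otherwise [al] grows at least like 2^k along the scales (3/2)^k. *)
Lemma balanced_scale (al : nat -> nat) (m0 : nat) : (2 <= m0)%N ->
  (forall m, (al m <= 2 * m)%N) ->
  exists2 m, (m0 <= m)%N & (al (3 * m)./2 <= al m + 2 * (al m)./2)%N.
Proof.
move=> m02 alb; apply: contrapT => no.
have {}no m : (m0 <= m)%N -> (al m + 2 * (al m)./2 < al (3 * m)./2)%N.
  by move=> h; rewrite ltnNge; apply/negP => h'; apply: no; exists m.
(* The ratio 3/2 is at most 2, as the gluing of boxes of sizes [m] and [n] demands, and more than
   4/3, so that [4 * n - 2 * m] exceeds [n + 2 * m]. *)
pose f k := iter k (fun m => (3 * m)./2) m0.
have fS k : f k.+1 = (3 * f k)./2 by [].
have fm k : (m0 <= f k)%N by elim: k => // k IH; rewrite fS; lia.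
have fub k : (2 ^ k * f k <= 3 ^ k * m0)%N.
  elim: k => [|k IH]; first by rewrite !expn0.
  rewrite fS !expnS; have : (2 * (3 * f k)./2 <= 3 * f k)%N by lia.
  by move: IH; set A := (2 ^ k)%N; set B := (3 ^ k)%N; nia.
have alf k : (2 ^ k <= al (f k.+1))%N.
  elim: k => [|k IH]; first by have := no _ (fm 0%N); rewrite -fS expn0; lia.
  have := no _ (fm k.+1); rewrite -fS expnS.
  have : (0 < 2 ^ k)%N by rewrite expn_gt0.
  lia.
have bern k : ((k + 3) * 3 ^ k <= 3 * 4 ^ k)%N.
  elim: k => // k IH; rewrite !expnS.
  by move: IH; set A := (4 ^ k)%N; set B := (3 ^ k)%N; nia.
(* Doubling against growth 3/2 bounds [4 ^ k] by [3 * 3 ^ k * m0]; with [bern] this gives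
   [k + 3 <= 12 * m0], which this [k] violates. *)
pose k := (12 * m0)%N.
have h1 := alf k; have h2 := alb (f k.+1); have h3 := fub k.+1; have h4 := bern k.
have e4 : (4 ^ k = 2 ^ k * 2 ^ k)%N by rewrite -expnMn.
have t0 : (0 < 3 ^ k)%N by rewrite expn_gt0.
have d0 : (0 < 2 ^ k)%N by rewrite expn_gt0.
rewrite !expnS in h3.
have h5 : (4 * (2 ^ k * 2 ^ k) <= 4 * (3 * 3 ^ k * m0))%N.
  have : (2 ^ k <= 2 * f k.+1)%N by lia.
  by move: h3; set A := (2 ^ k)%N; set B := (3 ^ k)%N; set C := f _; nia.
rewrite e4 in h4.
have h6 : ((k + 3) * 3 ^ k <= (12 * m0) * 3 ^ k)%N by
  move: h4 h5; set A := (2 ^ k * 2 ^ k)%N; set B := (3 ^ k)%N; nia.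
by rewrite leq_pmul2r // /k in h6; lia.
Qed.

Lemma infinitely_many_long_crossings : exists2 dl : R, 0 < dl &
  forall M : nat, exists H : nat, [/\ (M <= H)%N, ~~ odd H, (0 < H)%N &
    likely dl (crossing1 0 (3 * H)%:Z 0 H%:Z)].
Proof.
pose p : R := 2^-1 * 8^-1 ^+ 6.
have p0 : 0 < p by rewrite /p mulr_gt0 ?exprn_gt0 ?invr_gt0.
exists (p * (p * 2^-1) ^+ 28); first by rewrite mulr_gt0 ?exprn_gt0 ?mulr_gt0 ?invr_gt0.
move=> M.
have ex (m : nat) : exists al : nat, (0 < m)%N -> [/\ (al <= 2 * m)%N,
    likely (8^-1 : R) (to_right (2 * m) al%:Z (2 * m)%:Z) &
    likely (8^-1 : R) (to_right (2 * m) 0 al%:Z)].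
  have [m0|m0] := posnP m; first by exists 0%N; rewrite m0.
  by have [||al h] := @balance_height R (2 * m); [lia|lia|exists al].
have [al hal] := choice ex.
pose al' m := if (0 < m)%N then al m else 0%N.
(* From 8 on, the rounding in [n] still leaves an excess [6 * n - 8 * m] large enough for the 28
   gluings below to reach the aspect ratio 3. *)
have [|m|m hm good] := @balanced_scale al' (maxn M 8); first lia.
  by rewrite /al'; case: ifP => // /hal[].
have m0 : (0 < m)%N by lia.
pose n := (3 * m)./2; have n0 : (0 < n)%N by rewrite /n; lia.
move: good; rewrite /al' -/n m0 n0 => good.
have [alm hup _] := hal m m0; have [_ _ hmid] := hal n n0.
exists (2 * n + 2 * (2 * m))%N; split; [lia|lia|lia|].
(* The shift must be even: it is [- al m] rounded towards 0. Its requirement [y0 + al n <= al m] is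
   the inequality [good]. *)
have := @x_cluster_gluing (2 * m) (2 * n) (al m) (al n) (- (2 * (al m)./2)%:Z).
move=> /(_ _ _ _ _ _ alm _ _ _ _ hup hmid) h.
have {}h := h ltac:(lia) ltac:(lia) ltac:(lia) ltac:(rewrite /n; lia)
  ltac:(rewrite /n; lia) ltac:(lia) ltac:(lia) ltac:(lia) ltac:(lia).
set H := (2 * n + 2 * (2 * m))%N in h *.
have e : (4 * (2 * n) - 2 * (2 * m) = H + (6 * n - 8 * m))%N by rewrite /H /n; lia.
rewrite e in h.
have := long_crossings _ _ _ h 28 => /(_ ltac:(lia) ltac:(lia) ltac:(lia)) {}h.
apply: likely_linked h _ _; first exact: bounded_rect.
move=> c _ [x [y [/eqP x1 /eqP y1 cxy]]].
have [|||x' [y' [x'1 y'1 h'']]] :=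
    conn_crossing lipschitz1_fst cxy (a := 0) (b := (3 * H)%:Z).
- by rewrite x1.
- by [].
- by rewrite y1 /H /n; lia.
exists x', y'; split; [exact/eqP|exact/eqP|apply: conn_sub h''] => z.
by move=> /andP[/andP[->]]; rewrite /rect /=; lia.
Qed.
End RSW2.

(** * Blocked annuli *)

Definition supn (z : Z2) : int := Num.max `|z.1| `|z.2|.

Lemma lipschitz1_supn : lipschitz1 supn.
Proof. by move=> u v; rewrite /Z2_adj /supn; lia. Qed.

Definition closed_crossing (H : nat) (h : Z2 -> Z2) (c : coloring) : Prop :=
  crossing1 0 (3 * H)%:Z 0 H%:Z (fun z => ~~ c (h z)).

Definition dual_map (h : Z2 -> Z2) :=
  [/\ injective h, (forall z, is_vertex (h z) = is_face z) &
      (forall z, is_face (h z) = is_vertex z)].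

Section Blocking.
Variable R : realFieldType.

(** The counterpart of [likely] for decreasing events: [p] is again a lower bound for the
    probability. *)
Definition rare (p : R) (A : coloring -> Prop) :=
  [/\ local A, increasing (fun c => ~ A c), 0 <= p & p <= Pr R A].

Lemma rare_and p q A B : rare p A -> rare q B -> rare (p * q) (fun c => A c /\ B c).
Proof.
move=> [lA iA p0 pA] [lB iB q0 qB]; split.
- exact: local_and.
- move=> c c' cc' nAB [A' B']; apply: nAB; split.
    by apply: contrapT => /(iA _ _ cc').
  by apply: contrapT => /(iB _ _ cc').
- exact: mulr_ge0.
- by apply: le_trans (Pr_FKG_dec R lA lB iA iB); apply: ler_pM.
Qed.

Lemma rare_closed_crossing (p : R) H h : dual_map h ->
  likely p (crossing1 0 (3 * H)%:Z 0 H%:Z) -> rare p (closed_crossing H h).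
Proof.
move=> [ih vh fh] [lA iA p0 pA]; split=> //.
- exact: (@local_map h (fun c => crossing1 _ _ _ _ (fun z => ~~ c z)) (local_neg lA)).
- move=> c c' cc' nA A'; apply: nA; apply: iA A' => z; apply: contra.
  exact: cc'.
- by rewrite /closed_crossing (Pr_dual R lA ih vh fh).
Qed.
End Blocking.

Lemma closed_crossing_supported (H : nat) h :
  supported (map h (rect_seq 0 (3 * H)%:Z 0 H%:Z)) (closed_crossing H h).
Proof.
move=> c c' cc'.
apply: (linked_supported (@rect_seqP _ _ _ _)) => z zs.
by rewrite cc' //; apply: map_f.
Qed.

(** In the coordinates [g], the open path contains a vertical crossing of the rectangle, which would
    meet the closed horizontal one. *)
Lemma closed_crossing_blocks (H : nat) (Rr : int) (h g : Z2 -> Z2) (c : coloring) x y :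
  cancel g h -> (forall u v, Z2_adj u v -> Z2_adj (g u) (g v)) ->
  (forall z, supn z <= Rr -> 0 <= (g z).1 <= (3 * H)%:Z) ->
  closed_crossing H h c -> conn (fun z => c z && (supn z <= Rr)) x y ->
  (g x).2 <= 0 -> H%:Z <= (g y).2 -> False.
Proof.
move=> gh ag gb [p [q [/eqP p1 /eqP q1 cpq]]] cxy gx gy.
have lg : lipschitz1 (fun z => (g z).2) by move=> u v /ag/lipschitz1_snd.
have H0 : 0 <= H%:Z by [].
have [x' [y' [x'2 y'2 cxy']]] := conn_crossing lg cxy gx H0 gy.
have {}cxy' := @conn_map g _ (fun z => c (h z) && rect 0 (3 * H)%:Z 0 H%:Z z) _ _ ag _ cxy'.
have [z|||z] := crossings_meet _ _ cpq p1 q1 (cxy' _) x'2 y'2.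
- by case/andP.
- by move=> z /andP[].
- by move=> z /andP[/andP[cz /gb h1] h2]; rewrite gh cz /rect h1 h2.
- by move=> /andP[/andP[/negP nc _] /andP[cz _]]; apply: nc.
Qed.

Definition trapped (c : coloring) (r Rr : int) : Prop :=
  forall x y, conn c x y -> supn x <= r -> supn y < Rr.

(** Four rectangles of size [3 * H] by [H] surround the box [r], and each has a closed crossing in
    the long direction. An open path from the box [r] to the boundary of the box [Rr] ends on one of
    the four sides, thus has traversed the rectangle along that side; no circuit needs to be
    assembled. *)
Lemma blocked_annuli (R : realFieldType) : exists2 dl : R, 0 < dl <= 1 &
  forall M : nat, exists (r Rr : int) (s : seq Z2) (E : coloring -> Prop) (N : nat),
  [/\ M%:Z <= r, forall z, z \in s -> M%:Z <= supn z < N%:Z, supported s E,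
      dl <= Pr R E & forall c, E c -> trapped c r Rr].
Proof.
have [dl dl0 ex] := infinitely_many_long_crossings R.
have dl1 : dl <= 1.
  have [H [_ _ _ [lA _ _ h]]] := ex 0%N; apply: le_trans h _.
  by have := Pr_ge0 R (fun c => ~ crossing1 0 (3 * H)%:Z 0 H%:Z c); rewrite Pr_not // subr_ge0.
exists (dl * (dl * (dl * dl))).
  by rewrite !mulr_gt0 //= !mulr_ile1 ?mulr_ge0 // ltW // !mulr_gt0.
move=> M; have [H [MH eH H0 hH]] := ex (2 * M + 2)%N.
pose q := H./2.
(* The largest odd integer up to [3 * H / 2]: the rectangles are long enough to cover a side of the
   box [Rr], and with [Rr] and [r] odd the four maps below exchange vertices and faces. *)
pose Rr : int := if odd q then (3 * q)%:Z else (3 * q)%:Z - 1.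
pose r : int := Rr - H%:Z.
have Rodd : (Rr %% 2)%Z = 1 by rewrite /Rr; case: ifP; lia.
have rodd : (r %% 2)%Z = 1 by rewrite /r; lia.
have R3 : 2 * Rr <= (3 * H)%:Z by rewrite /Rr; case: ifP; rewrite /q; lia.
have rM : M%:Z <= r by rewrite /r /Rr /q; case: ifP; lia.
have RrH : Rr <= (3 * H)%:Z by lia.
have R0 : 0 <= Rr by rewrite /r in rM; lia.
pose ht (z : Z2) : Z2 := (z.1 - Rr, z.2 + r).
pose hb (z : Z2) : Z2 := (z.1 - Rr, - (z.2 + r)).
pose hr (z : Z2) : Z2 := (z.2 + r, z.1 - Rr).
pose hl (z : Z2) : Z2 := (- (z.2 + r), z.1 - Rr).
have dt : dual_map ht.
  by split=> [[x1 x2] [y1 y2] [/addIr -> /addIr ->]//|z|z]; rewrite /is_vertex /is_face /=; lia.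
have db : dual_map hb.
  by split=> [[x1 x2] [y1 y2] [/addIr -> /oppr_inj/addIr ->]//|z|z]; rewrite /is_vertex /is_face /=; lia.
have dr : dual_map hr.
  by split=> [[x1 x2] [y1 y2] [/addIr -> /addIr ->]//|z|z]; rewrite /is_vertex /is_face /=; lia.
have dl' : dual_map hl.
  by split=> [[x1 x2] [y1 y2] [/oppr_inj/addIr -> /addIr ->]//|z|z]; rewrite /is_vertex /is_face /=; lia.
have [lE _ _ PE] := rare_and (rare_closed_crossing dt hH) (rare_and (rare_closed_crossing db hH)
  (rare_and (rare_closed_crossing dr hH) (rare_closed_crossing dl' hH))).
pose rs := rect_seq 0 (3 * H)%:Z 0 H%:Z.
pose s := map ht rs ++ (map hb rs ++ (map hr rs ++ map hl rs)).
exists r, Rr, s, (fun c => closed_crossing H ht c /\ closed_crossing H hb c /\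
  closed_crossing H hr c /\ closed_crossing H hl c), (3 * H).+1; split; [by []| | |exact: PE|].
- have rsP z : z \in rs -> rect 0 (3 * H)%:Z 0 H%:Z z.
    by case/allpairsP=> -[i j] []; rewrite !mem_iota /rect /= => hi hj -> /=; lia.
  move=> z; rewrite !mem_cat => /or4P[] /mapP[w /rsP hw ->]; move: hw;
    rewrite /rect /supn /=; rewrite /r in rM *; lia.
- have sh h : {subset map h rs <= s} -> supported s (closed_crossing H h).
    by move=> hs; apply: (supported_sub hs); apply: closed_crossing_supported.
  have [h1 h2 h3 h4] : [/\ supported s (closed_crossing H ht), supported s (closed_crossing H hb),
      supported s (closed_crossing H hr) & supported s (closed_crossing H hl)].
    by split; apply: sh => z zs; rewrite !mem_cat zs ?orbT.
  exact: supported_and h1 (supported_and h2 (supported_and h3 h4)).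
- move=> c [Et [Eb [Er El]]] x y cxy xr; rewrite ltNge; apply/negP => yR.
  have [|||x' [y' [x's y's cxy']]] := conn_crossing lipschitz1_supn cxy (a := r) (b := Rr).
  + by [].
  + by rewrite /r; lia.
  + by [].
  have {}cxy' : conn (fun z => c z && (supn z <= Rr)) x' y'.
    by apply: conn_sub cxy' => z /andP[-> /andP[]].
  have : [\/ y'.2 = Rr, y'.2 = - Rr, y'.1 = Rr | y'.1 = - Rr].
    move: y's; rewrite /supn => y's.
    case: (eqVneq y'.2 Rr) => h1; first exact: Or41.
    case: (eqVneq y'.2 (- Rr)) => h2; first exact: Or42.
    by case: (eqVneq y'.1 Rr) => h3; [exact: Or43|apply: Or44; lia].
  case=> hy.
  + apply: (@closed_crossing_blocks H Rr ht (fun z => (z.1 + Rr, z.2 - r)) c x' y') => //=.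
    * by move=> [z1 z2]; rewrite /ht /= addrK subrK.
    * by move=> u v; rewrite /Z2_adj /=; lia.
    * by move=> z; rewrite /supn; lia.
    * by move: x's; rewrite /supn; lia.
    * by rewrite hy /r; lia.
  + apply: (@closed_crossing_blocks H Rr hb (fun z => (z.1 + Rr, - z.2 - r)) c x' y') => //=.
    * by move=> [z1 z2]; rewrite /hb /= addrK subrK opprK.
    * by move=> u v; rewrite /Z2_adj /=; lia.
    * by move=> z; rewrite /supn; lia.
    * by move: x's; rewrite /supn; lia.
    * by rewrite hy /r; lia.
  + apply: (@closed_crossing_blocks H Rr hr (fun z => (z.2 + Rr, z.1 - r)) c x' y') => //=.
    * by move=> [z1 z2]; rewrite /hr /= addrK subrK.
    * by move=> u v; rewrite /Z2_adj /=; lia.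
    * by move=> z; rewrite /supn; lia.
    * by move: x's; rewrite /supn; lia.
    * by rewrite hy /r; lia.
  + apply: (@closed_crossing_blocks H Rr hl (fun z => (z.2 + Rr, - z.1 - r)) c x' y') => //=.
    * by move=> [z1 z2]; rewrite /hl /= addrK subrK opprK.
    * by move=> u v; rewrite /Z2_adj /=; lia.
    * by move=> z; rewrite /supn; lia.
    * by move: x's; rewrite /supn; lia.
    * by rewrite hy /r; lia.
Qed.

(** Each annulus starts beyond the support of the previous one, so the failures of [k] annuli are
    independent; [F] says that all of them fail. *)
Lemma trapped_eventually (R : realFieldType) : exists2 dl : R, 0 < dl <= 1 &
  forall (k M : nat), exists (s : seq Z2) (F : coloring -> Prop),
  [/\ forall z, z \in s -> M%:Z <= supn z, supported s F, Pr R F <= (1 - dl) ^+ k &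
      forall c, ~ F c -> exists r Rr, M%:Z <= r /\ trapped c r Rr].
Proof.
have [dl /andP[dl0 dl1] ex] := blocked_annuli R; exists dl; first by rewrite dl0.
elim=> [|k IH] M.
  exists [::], (fun=> True); split=> //.
  by rewrite expr0 (PrE _ (fun=> false) (s := [::])) //= /event_indic asboolT.
have [r [Rr [s [E [N [Mr sMN sE PE hE]]]]]] := ex M.
have [t [F [tN tF PF hF]]] := IH (maxn M N).
have snE := supported_not sE.
exists (s ++ t), (fun c => ~ E c /\ F c); split.
- by move=> z; rewrite mem_cat => /orP[/sMN/andP[]//|/tN]; lia.
- apply: supported_and.
    by apply: supported_sub snE => z; rewrite mem_cat => ->.
  by apply: supported_sub tF => z; rewrite mem_cat orbC => ->.
- rewrite (Pr_indep R snE tF); last first.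
    by move=> z zs; apply/negP => /tN; have := sMN _ zs; lia.
  rewrite exprS; apply: ler_pM => //; try exact: Pr_ge0.
  by rewrite Pr_not ?lerD2l ?lerN2 //; exists s.
- move=> c nEF; have [Ec|nE] := pselect (E c); first by exists r, Rr; split=> //; apply: hE.
  have /hF[r' [R' [h1 h2]]] : ~ F c by move=> Fc; apply: nEF.
  by exists r', R'; split=> //; lia.
Qed.

(** * Almost sure absence of percolation *)

Section PowersTendToZero.
Import numFieldNormedType.Exports.

Lemma expr_bound_le0 (R : realType) (x p : R) : 0 <= x < 1 -> (forall k, p <= x ^+ k) -> p <= 0.
Proof.
move=> /andP[x0 x1] h.
have cv : (fun n => x ^+ n) @ \oo --> 0 by apply: cvg_expr; rewrite ger0_norm.
rewrite -(cvg_lim _ cv) //; apply: limr_ge; first by apply/cvg_ex; exists 0.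
by apply: nearW => n; apply: h.
Qed.

End PowersTendToZero.

Definition is_midpoint (z : Z2) := ~~ is_vertex z && ~~ is_face z.

(* The edge whose midpoint is drawn at [z] in the doubled lattice. *)
Definition edge_at (z : Z2) : {fset Z2} :=
  [fset ((z.1 %/ 2)%Z, (z.2 %/ 2)%Z); (((z.1 + 1) %/ 2)%Z, ((z.2 + 1) %/ 2)%Z)].

Lemma edge_at_edges z : is_midpoint z -> edges Z2_adj (edge_at z).
Proof.
move=> mz; exists (((z.1 %/ 2)%Z, (z.2 %/ 2)%Z), (((z.1 + 1) %/ 2)%Z, ((z.2 + 1) %/ 2)%Z)) => //.
by move: mz; rewrite /arcs /Z2_adj /is_midpoint /is_vertex /is_face /=; lia.
Qed.

Lemma edge_at_inj z w : is_midpoint z -> is_midpoint w -> edge_at z = edge_at w -> z = w.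
Proof.
move=> mz mw /fsetP h.
have := h ((z.1 %/ 2)%Z, (z.2 %/ 2)%Z).
have := h (((z.1 + 1) %/ 2)%Z, ((z.2 + 1) %/ 2)%Z).
rewrite !inE !eqxx orbT /= -!pair_eqE /= => h1 h2; apply/eqP.
move: mz mw h1 h2; rewrite /is_midpoint /is_vertex /is_face.
case: z w {h} => [z1 z2] [w1 w2]; rewrite -pair_eqE /=; lia.
Qed.

Definition half_line (R : realType) (b : bool) : set R := [set x | (x <= 2^-1) = b].

Lemma half_lineT (R : realType) : @half_line R true = [set` `]-oo, 2^-1 : R]].
Proof. by apply/seteqP; split => x /=; rewrite in_itv. Qed.

Lemma half_lineF (R : realType) : @half_line R false = ~` @half_line R true.
Proof. by apply/seteqP; split => x /=; rewrite /half_line /=; case: (_ <= _). Qed.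

Lemma measurable_half_line (R : realType) b : measurable (@half_line R b).
Proof.
have mT : measurable (@half_line R true) by rewrite half_lineT; apply: measurable_itv.
by case: b => //; rewrite half_lineF; apply: measurableC.
Qed.

Lemma uniform_prob_half_line (R : realType) :
  uniform_prob (@ltr01 R) (@half_line R true) = (2^-1)%:E.
Proof.
rewrite half_lineT.
rewrite /uniform_prob integral_uniform_pdf.
have -> : `]-oo, 2^-1] `&` `[0, 1] = [set` `[0 : R, 2^-1]].
  apply/seteqP; split => x /=; rewrite !in_itv /=; lra.
rewrite (eq_integral (fun=> 1%:E)); last first.
  move=> x; rewrite inE /= in_itv /= /uniform_pdf => hx.
  by rewrite ifT ?subr0 ?invr1 //; lra.
by rewrite integral_cst //= lebesgue_measure_itv /= lte_fin invr_gt0 ltr0n /= mul1e sube0.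
Qed.

Section FairEdges.
Variables (R : realType) (d : measure_display) (Omega : measurableType d).
Variables (P : probability Omega R) (U : {fset Z2} -> {RV P >-> R}).
Hypothesis iidU : iid_uniform01 (edges Z2_adj) U.

Definition bits (w : Omega) (z : Z2) : bool := U (edge_at z) w <= 2^-1.

Lemma measurable_bit (e : {fset Z2}) (b : bool) : measurable (U e @^-1` @half_line R b).
Proof.
rewrite -[X in measurable X]setTI; apply: (measurable_funP (U e)) => //.
exact: measurable_half_line.
Qed.

Lemma prob_bit (e : {fset Z2}) (b : bool) : edges Z2_adj e ->
  P (U e @^-1` @half_line R b) = (2^-1)%:E.
Proof.
move=> ee; have [_ /(_ e ee) uU] := iidU.
have h : P (U e @^-1` @half_line R true) = (2^-1)%:E.
  by have := uU _ (@measurable_half_line R true); rewrite uniform_prob_half_line.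
case: b => //; rewrite half_lineF -preimage_setC probability_setC.
  by rewrite h -EFinB; congr EFin; lra.
exact: measurable_bit.
Qed.

Lemma cylinder_prob (s : seq Z2) (sg : Z2 -> bool) :
  uniq s -> all is_midpoint s ->
  measurable [set w | {in s, bits w =1 sg}] /\
  P [set w | {in s, bits w =1 sg}] = ((2^-1) ^+ size s)%:E.
Proof.
move=> us ms; have [ind _] := iidU.
(* The bits are transported from midpoints to edges, where independence is assumed; [edge_at] is
   injective on midpoints. *)
pose b e := `[< exists2 z, z \in s & edge_at z = e /\ sg z >].
have bE z : z \in s -> b (edge_at z) = sg z.
  move=> zs; apply/asboolP/idP => [[z' zs' [e sz]]|sz]; last by exists z.
  by have <- // : z' = z; apply: edge_at_inj => //; apply: (allP ms).
pose J : {fset {fset Z2}} := [fset e in map edge_at s].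
pose A (e : {fset Z2}) : set R := @half_line R (b e).
have -> : [set w | {in s, bits w =1 sg}] = \bigcap_(e in [set` J]) (U e @^-1` A e).
  apply/seteqP; split => w /=.
    move=> h e /=; rewrite !inE => /mapP[z zs ->]; have := h z zs.
    by rewrite /A /half_line /= bE.
  move=> h z zs; have := h (edge_at z); rewrite /= !inE map_f // => /(_ isT).
  by rewrite /A /half_line /= bE.
have mA e : measurable (A e) by apply: measurable_half_line.
have JE : [set` J] `<=` edges Z2_adj.
  by move=> e /=; rewrite !inE => /mapP[z zs ->]; apply/edge_at_edges/(allP ms).
split.
  apply: fin_bigcap_measurable; first exact: finite_fset.
  by move=> e _; apply: measurable_bit.
rewrite (ind J A JE mA).
rewrite (eq_big_seq (fun=> (2^-1)%:E)); last first.
  by move=> e eJ; apply: prob_bit; apply: JE.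
have pE (t : seq {fset Z2}) : (\prod_(e <- t) (2^-1 : R)%:E)%E = (2^-1 ^+ size t)%:E.
  by elim: t => [|e t IH]; rewrite ?big_nil // big_cons IH exprS EFinM.
rewrite pE; congr (_ ^+ _)%:E.
rewrite -(size_map edge_at) -(undup_id (s := map edge_at s)); last first.
  rewrite map_inj_in_uniq // => z w /(allP ms) hz /(allP ms) hw; exact: edge_at_inj.
by rewrite -card_fseq cardfE.
Qed.

(** The bits at [t] are prescribed and those at [s] averaged. Moving the head of [s] to [t] splits
    the event according to its bit, exactly as [Ex] does, until only a cylinder is left. *)
Lemma cylinder_event_prob (f : (Z2 -> bool) -> Prop) (s t : seq Z2) (sg : Z2 -> bool) :
  uniq (s ++ t) -> all is_midpoint (s ++ t) -> dep_on (s ++ t) f ->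
  measurable [set w | {in t, bits w =1 sg} /\ f (bits w)] /\
  P [set w | {in t, bits w =1 sg} /\ f (bits w)] =
    ((2^-1) ^+ size t * Ex s (fun u => (`[< f u >])%:R) sg)%:E.
Proof.
elim: s t sg => [|x s IH] t sg ust mst df.
  rewrite /= in ust mst df *; have [mC PC] := cylinder_prob sg ust mst.
  have [fs|nfs] := pselect (f sg).
    have -> : [set w | {in t, bits w =1 sg} /\ f (bits w)] = [set w | {in t, bits w =1 sg}].
      apply/seteqP; split => w /=; first by case.
      by move=> h; split=> //; rewrite (df _ _ h).
    by rewrite asboolT // mulr1.
  have -> : [set w | {in t, bits w =1 sg} /\ f (bits w)] = set0.
    by apply/seteqP; split => w //= -[h]; rewrite (df _ _ h).
  by rewrite measure0 asboolF // mulr0.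
have xt : x \notin t.
  by move: ust; rewrite /= mem_cat negb_or => /andP[/andP[]].
have perm : perm_eq (s ++ x :: t) ((x :: s) ++ t) by rewrite -cat1s perm_catCA.
have split_x b w : {in x :: t, bits w =1 upd sg x b} <->
    bits w x = b /\ {in t, bits w =1 sg}.
  split=> [h|[hx ht] z].
    split=> [|z zt]; first by rewrite h ?inE ?eqxx // upd_eq.
    rewrite h ?inE ?zt ?orbT // /upd; case: eqP => // zx.
    by rewrite -zx zt in xt.
  rewrite inE /upd; case: eqP => [-> //|_ /= zt]; exact: ht.
have H b := IH (x :: t) (upd sg x b).
have {}H b : measurable [set w | {in x :: t, bits w =1 upd sg x b} /\ f (bits w)] /\
    P [set w | {in x :: t, bits w =1 upd sg x b} /\ f (bits w)] =
    ((2^-1) ^+ (size t).+1 * Ex s (fun u => (`[< f u >])%:R) (upd sg x b))%:E.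
  apply: H; first by rewrite (perm_uniq perm).
    by rewrite (perm_all _ perm).
  by move=> u u' uu'; apply: df => z zs; apply: uu'; rewrite (perm_mem perm).
pose E b := [set w | {in x :: t, bits w =1 upd sg x b} /\ f (bits w)].
have -> : [set w | {in t, bits w =1 sg} /\ f (bits w)] = E true `|` E false.
  apply/seteqP; split => w /=; last first.
    by move=> [] [/split_x[_ ht] fw].
  move=> [ht fw]; case e : (bits w x); [left|right]; split=> //; exact/split_x.
have [m1 P1] := H true; have [m2 P2] := H false.
split; first exact: measurableU.
have disj : E true `&` E false = set0.
  apply/seteqP; split => w //= [[/split_x[e1 _] _] [/split_x[e2 _] _]].
  by rewrite e1 in e2.
have -> : P (E true `|` E false) = (P (E true) + P (E false))%E by exact: measureU.
by rewrite P1 P2 -EFinD /= exprS; congr EFin; field.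
Qed.

Lemma local_event_prob (A : coloring -> Prop) : local A ->
  measurable [set w | A (coloring_of (bits w))] /\
  P [set w | A (coloring_of (bits w))] = (Pr R A)%:E.
Proof.
move=> [s sA]; pose t := undup [seq z <- s | is_midpoint z].
have dt : dep_on t (fun sg => A (coloring_of sg)).
  have h u u' : {in t, u =1 u'} -> A (coloring_of u) -> A (coloring_of u').
    move=> uu'; apply: sA => z zs; rewrite /coloring_of.
    case E : (is_vertex z) => //=; case F : (is_face z) => //=.
    by apply: uu'; rewrite mem_undup mem_filter zs /is_midpoint E F.
  move=> u u' uu'; apply/propext; split; apply: h => // z zt.
  by rewrite uu'.
have [|||+ +] := @cylinder_event_prob (fun sg => A (coloring_of sg)) t [::] (fun=> false).
- by rewrite cats0 undup_uniq.
- by rewrite cats0; apply/allP => z; rewrite mem_undup mem_filter => /andP[].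
- by rewrite cats0.
have -> : [set w | {in [::], bits w =1 (fun=> false)} /\ A (coloring_of (bits w))] =
    [set w | A (coloring_of (bits w))].
  by apply/seteqP; split => w /= => [[]|].
rewrite expr0 mul1r => mA ->; split=> //; congr EFin.
rewrite (PrE R (fun=> false) sA); apply: dep_Ex2.
  by move=> u u' uu'; congr (nat_of_bool _)%:R; congr asbool; apply: dt.
exact: dep_on_indic.
Qed.

(** The failures of [Q] lie in the intersection of the events [F k], which is measurable and of
    probability at most [x ^+ k] for every [k]. *)
Lemma ae_coloring (Q : coloring -> Prop) (x : R) : 0 <= x < 1 ->
  (forall k, exists F, [/\ local F, Pr R F <= x ^+ k & forall c, ~ F c -> Q c]) ->
  {ae P, forall w, Q (coloring_of (bits w))}.
Proof.
move=> x01 /choice[F hF].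
pose E k := [set w | F k (coloring_of (bits w))].
have mE k : measurable (E k) by have [/local_event_prob[]] := hF k.
have PE k : P (E k) = (Pr R (F k))%:E by have [/local_event_prob[]] := hF k.
exists (\bigcap_k E k); split.
- exact: bigcapT_measurable.
- have lek k : (P (\bigcap_k E k) <= (x ^+ k)%:E)%E.
    apply: (@le_trans _ _ (P (E k))); last first.
      by rewrite PE lee_fin; have [] := hF k.
    apply: le_measure; rewrite ?inE //; first exact: bigcapT_measurable.
    exact: bigcap_inf.
  have fin : P (\bigcap_k E k) \is a fin_num.
    by apply: fin_num_measure; apply: bigcapT_measurable.
  apply/eqP; rewrite eq_le measure_ge0 andbT -(fineK fin) lee_fin.
  by apply: (expr_bound_le0 x01) => k; rewrite -lee_fin fineK.
- move=> w /= nQ k _; apply: contrapT => nF; apply: nQ.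
  by have [_ _] := hF k; apply.
Qed.

(* Harris' theorem at p = 1/2, for the open clusters and for the closed dual ones. *)
Lemma ae_trapped : {ae P, forall w, forall M : nat,
  (exists r Rr, M%:Z <= r /\ trapped (coloring_of (bits w)) r Rr) /\
  (exists r Rr, M%:Z <= r /\
     trapped (fun z => ~~ coloring_of (bits w) (translation 1 1 z)) r Rr)}.
Proof.
have [dl /andP[dl0 dl1] ex] := trapped_eventually R.
have x01 : 0 <= 1 - dl < 1 by lra.
apply: ae_foralln => M.
have h1 : {ae P, forall w,
    exists r Rr, M%:Z <= r /\ trapped (coloring_of (bits w)) r Rr}.
  apply: (ae_coloring (Q := fun c => exists r Rr, M%:Z <= r /\ trapped c r Rr) x01) => k.
  by have [s [F [_ sF PF hF]]] := ex k M; exists F; split=> //; exists s.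
have h2 : {ae P, forall w, exists r Rr, M%:Z <= r /\
     trapped (fun z => ~~ coloring_of (bits w) (translation 1 1 z)) r Rr}.
  apply: (ae_coloring (Q := fun c => exists r Rr, M%:Z <= r /\
    trapped (fun z => ~~ c (translation 1 1 z)) r Rr) x01) => k.
  have [s [F [_ sF PF hF]]] := ex k M.
  exists (fun c => F (fun z => ~~ c (translation 1 1 z))); split.
  - apply: (@local_map (translation 1 1) (fun c => F (fun z => ~~ c z))).
    by apply: local_neg; exists s.
  - rewrite Pr_dual //; first by exists s.
    + by move=> [x1 x2] [y1 y2] [/addIr -> /addIr ->].
    + by move=> z; rewrite /is_vertex /is_face /translation /=; lia.
    + by move=> z; rewrite /is_vertex /is_face /translation /=; lia.
  - by move=> c /hF.
by apply: filterS2 h1 h2 => w.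
Qed.

End FairEdges.

(** * Harmonic functions and cutoffs *)

Definition rt (z : Z2) : Z2 := (z.1 + 1, z.2).
Definition lf (z : Z2) : Z2 := (z.1 - 1, z.2).
Definition up (z : Z2) : Z2 := (z.1, z.2 + 1).
Definition dn (z : Z2) : Z2 := (z.1, z.2 - 1).

Lemma rtK : cancel rt lf. Proof. by move=> [x y]; rewrite /lf /rt /= addrK. Qed.
Lemma lfK : cancel lf rt. Proof. by move=> [x y]; rewrite /lf /rt /= subrK. Qed.
Lemma upK : cancel up dn. Proof. by move=> [x y]; rewrite /up /dn /= addrK. Qed.
Lemma dnK : cancel dn up. Proof. by move=> [x y]; rewrite /up /dn /= subrK. Qed.

Lemma rect_seq_supn (n : nat) z : supn z <= n%:Z ->
  z \in rect_seq (- n%:Z) n%:Z (- n%:Z) n%:Z.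
Proof. by move=> h; apply: rect_seqP; move: h; rewrite /rect /supn; lia. Qed.

Lemma supn_lf (n : nat) z : supn z <= n%:Z -> supn (lf z) <= n.+1%:Z.
Proof. by rewrite /supn /=; lia. Qed.

Lemma supn_dn (n : nat) z : supn z <= n%:Z -> supn (dn z) <= n.+1%:Z.
Proof. by rewrite /supn /=; lia. Qed.

Lemma supnS (n : nat) z : supn z <= n%:Z -> supn z <= n.+1%:Z.
Proof. lia. Qed.

Section FiniteSums.
Variables (R : realFieldType) (T : eqType).
Implicit Types (h : T -> R) (s t : seq T).

Lemma sum_support h s t : uniq s -> uniq t -> (forall x, h x != 0 -> x \in s) ->
  (forall x, h x != 0 -> x \in t) -> \sum_(x <- s) h x = \sum_(x <- t) h x.
Proof.
move=> us ut hs ht.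
have E u : \sum_(x <- u) h x = \sum_(x <- [seq x <- u | h x != 0]) h x.
  rewrite big_filter [LHS](bigID (fun x => h x != 0)) /=.
  by rewrite [X in _ + X]big1 ?addr0 // => x /negPn/eqP.
rewrite E [RHS]E; apply: perm_big; apply: uniq_perm; rewrite ?filter_uniq // => x.
by rewrite !mem_filter; case: eqP => //= /eqP hx; rewrite hs ?ht.
Qed.

Lemma ler_sum_subset h s t : uniq s -> uniq t -> {subset s <= t} ->
  (forall x, 0 <= h x) -> \sum_(x <- s) h x <= \sum_(x <- t) h x.
Proof.
move=> us ut st h0.
rewrite [leRHS](bigID (fun x => x \in s)) /= -[leLHS]addr0; apply: lerD; last first.
  by apply: sumr_ge0.
rewrite le_eqVlt; apply/orP; left; apply/eqP; rewrite -[RHS]big_filter.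
apply: perm_big; apply: uniq_perm; rewrite ?filter_uniq // => x.
by rewrite mem_filter; case: (boolP (x \in s)) => //= /st ->.
Qed.

Lemma ler_term_sum h s x : uniq s -> x \in s -> (forall y, 0 <= h y) ->
  h x <= \sum_(y <- s) h y.
Proof. by move=> us xs h0; rewrite (bigD1_seq x) //= lerDl; apply: sumr_ge0. Qed.

End FiniteSums.

Lemma rect_seq_uniq a b c d : uniq (rect_seq a b c d).
Proof.
apply: allpairs_uniq; rewrite ?iota_uniq // => -[i j] [i' j'] _ _ /=.
by case=> /addrI[->] /addrI[->].
Qed.

Section Liouville.
Variable R : realFieldType.
Implicit Types (a b u f : Z2 -> R) (z : Z2).

(* Conductances of the square lattice: [a z] is that of the edge from [z] to
   [rt z] and [b z] that of the edge from [z] to [up z]. *)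
Definition energy_density a b u z : R :=
  a z * (u z - u (rt z)) ^+ 2 + b z * (u z - u (up z)) ^+ 2.

Definition energy_le a b u (M : R) :=
  forall s : seq Z2, uniq s -> \sum_(z <- s) energy_density a b u z <= M.

Definition network_harmonic a b f := forall z,
  a z * (f z - f (rt z)) - a (lf z) * (f (lf z) - f z) +
  (b z * (f z - f (up z)) - b (dn z) * (f (dn z) - f z)) = 0.

(** Recurrence of the network: the effective conductance from any box to infinity vanishes. *)
Definition has_cutoffs a b := forall (n : nat) (e : R), 0 < e ->
  exists (chi : Z2 -> R) (N : nat),
  [/\ forall z, 0 <= chi z, forall z, supn z <= n%:Z -> chi z = 1,
      forall z, N%:Z < supn z -> chi z = 0 & energy_le a b chi e].

Lemma sum_by_shift (g : Z2 -> Z2) (g' : Z2 -> Z2) (h : Z2 -> R) (s : seq Z2) : uniq s ->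
  cancel g g' -> cancel g' g ->
  (forall z, h z != 0 -> z \in s) -> (forall z, h z != 0 -> g' z \in s) ->
  \sum_(z <- s) h z = \sum_(z <- s) h (g z).
Proof.
move=> us gK g'K hs hs'; rewrite -(big_map g xpredT h); apply: sum_support => //.
  by rewrite map_inj_uniq //; apply: can_inj gK.
by move=> z /hs' hz; apply/mapP; exists (g' z).
Qed.

(** Young's inequality with weight [t], by completing the square of [t * |p| - |q|]. *)
Lemma cross_term_bound (k t y p q : R) : 0 < t -> - k <= y <= k ->
  - (k * t / 2 * p ^+ 2 + k / (2 * t) * q ^+ 2) <= y * p * q.
Proof.
move=> t0 hy.
have k0 : 0 <= k by lra.
have e : k * t / 2 * p ^+ 2 + k / (2 * t) * q ^+ 2 - k * (`|p| * `|q|) =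
    k / (2 * t) * (t * `|p| - `|q|) ^+ 2.
  by rewrite -(real_normK (num_real p)) -(real_normK (num_real q)); field; rewrite gt_eqF.
have h : `|y * p * q| <= k * (`|p| * `|q|).
  rewrite -mulrA normrM normrM; apply: ler_pM; rewrite ?mulr_ge0 ?normr_ge0 //.
  by rewrite ler_norml.
have h' : 0 <= k / (2 * t) * (t * `|p| - `|q|) ^+ 2.
  by rewrite mulr_ge0 ?sqr_ge0 // divr_ge0 // mulr_ge0 // ltW.
move: h; rewrite ler_norml => /andP[h _]; apply: le_trans h.
by rewrite lerN2 -subr_ge0 e.
Qed.

(** Discrete Leibniz rule [x p - y q = x (p - q) + (x - y) q], the last term being treated by
    [cross_term_bound]. *)
Lemma cutoff_term_bound (k t c d p q x y : R) : 0 < t -> - k <= q <= k -> 0 <= c ->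
  x * (c * (d * (p - q))) - (k * t / 2 * (c * d ^+ 2) + k / (2 * t) * (c * (x - y) ^+ 2)) <=
  c * d * (x * p - y * q).
Proof.
move=> t0 hq c0.
have := ler_wpM2l c0 (cross_term_bound d (x - y) t0 hq).
set A := k * t / 2; set B := k / (2 * t).
rewrite -subr_ge0 => h; rewrite -subr_ge0; apply: le_trans h _.
rewrite le_eqVlt; apply/orP; left; apply/eqP; ring.
Qed.

(** Truncation keeps the test function bounded, as [cross_term_bound] requires, while [f] may be
    unbounded. *)
Definition clamp (k x : R) : R := Num.max (- k) (Num.min k x).

Lemma clamp_bound k x : 0 <= k -> - k <= clamp k x <= k.
Proof. by move=> k0; rewrite /clamp le_max lexx /= ge_max ge_min lexx /= andbT; lra. Qed.

Lemma clamp_id k x : `|x| <= k -> clamp k x = x.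
Proof. by by rewrite ler_norml /clamp => /andP[h1 h2]; rewrite (min_idPr h2) (max_idPr h1). Qed.

Lemma clamp_mono (k x y : R) : 0 <= k -> 0 <= (x - y) * (clamp k x - clamp k y).
Proof.
move=> k0; have mono (u v : R) : u <= v -> clamp k u <= clamp k v.
  by move=> uv; rewrite /clamp ge_max !le_max lexx /= !le_min !ge_min lexx uv /= !orbT.
have [xy|yx] := leP x y; first by rewrite mulr_le0 ?subr_le0 // mono.
by rewrite mulr_ge0 ?subr_ge0 ?(ltW yx) // mono // ltW.
Qed.

(* Testing harmonicity of [f] against [chi * clamp k f]: the main term dominates
   the energy of [f] where [chi = 1] and [|f| <= k], and the other one tends to 0
   with the energy of [chi]. *)
Lemma harmonic_constant a b f (M : R) :
  (forall z, 0 <= a z) -> (forall z, 0 <= b z) -> network_harmonic a b f ->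
  energy_le a b f M -> has_cutoffs a b ->
  forall z, energy_density a b f z = 0.
Proof.
move=> a0 b0 hf fM cut z0.
have dens0 u z : 0 <= energy_density a b u z.
  by rewrite /energy_density addr_ge0 // mulr_ge0 ?sqr_ge0.
have M0 : 0 <= M by have := fM [::] isT; rewrite big_nil.
apply/eqP; rewrite eq_le dens0 andbT leNgt; apply/negP.
set E0 := energy_density a b f z0 => E00.
(* Large enough that [f] is not truncated at [z0], [rt z0] and [up z0]. *)
pose k : R := 1 + `|f z0| + `|f (rt z0)| + `|f (up z0)|.
have nz0 := normr_ge0 (f z0); have nz1 := normr_ge0 (f (rt z0)).
have nz2 := normr_ge0 (f (up z0)).
have k1 : 1 <= k by rewrite /k; lra.
have k0 : 0 <= k by lra.
(* With these [t] and [e] the two error terms are at most [E0 / 2] and [E0 / 4], which add up to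
   less than [E0]. *)
pose t := E0 / (k * (M + 1)).
have t0 : 0 < t by rewrite divr_gt0 // mulr_gt0 //; lra.
pose e := E0 * t / (2 * k).
have kp : 0 < k by lra.
have e0 : 0 < e by rewrite /e divr_gt0 // mulr_gt0.
have hs : supn z0 <= `|supn z0|%N.+1%:Z by rewrite /supn; clear; lia.
have [chi [N [chi0 chi1 chiN chie]]] := cut `|supn z0|%N.+1 e e0.
pose fk z := clamp k (f z).
pose g z := chi z * fk z.
pose s := rect_seq (- N.+1%:Z) N.+1%:Z (- N.+1%:Z) N.+1%:Z.
have us : uniq s by apply: rect_seq_uniq.
have gN z : g z != 0 -> supn z <= N%:Z.
  by rewrite leNgt; apply: contra => /chiN h; rewrite /g h mul0r.
have inS z : supn z <= N.+1%:Z -> z \in s.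
  by apply: rect_seq_supn.
pose J1 z := a z * (f z - f (rt z)); pose J2 z := b z * (f z - f (up z)).
(* Summation by parts; [s] is one unit larger than the support of [g], which leaves room for the
   shifts. *)
have parts : \sum_(z <- s) (J1 z * (g z - g (rt z)) + J2 z * (g z - g (up z))) = 0.
  have E1 : \sum_(z <- s) g z * J1 (lf z) = \sum_(z <- s) g (rt z) * J1 z.
    rewrite (sum_by_shift us rtK lfK); first by apply: eq_bigr => z _; rewrite rtK.
      by move=> z; rewrite mulf_eq0 negb_or => /andP[/gN/supnS/inS].
    by move=> z; rewrite mulf_eq0 negb_or => /andP[/gN/supn_lf/inS].
  have E2 : \sum_(z <- s) g z * J2 (dn z) = \sum_(z <- s) g (up z) * J2 z.
    rewrite (sum_by_shift us upK dnK); first by apply: eq_bigr => z _; rewrite upK.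
      by move=> z; rewrite mulf_eq0 negb_or => /andP[/gN/supnS/inS].
    by move=> z; rewrite mulf_eq0 negb_or => /andP[/gN/supn_dn/inS].
  transitivity (\sum_(z <- s) g z * J1 z - \sum_(z <- s) g z * J1 (lf z) +
      (\sum_(z <- s) g z * J2 z - \sum_(z <- s) g z * J2 (dn z))).
    rewrite E1 E2 -!sumrB -big_split; apply: eq_bigr => z _ /=; ring.
  rewrite -!sumrB -big_split big1 // => z _ /=.
  rewrite -!mulrBr -mulrDr /J1 /J2 lfK dnK hf mulr0 //.
pose Tm z := chi z * (a z * ((f z - f (rt z)) * (fk z - fk (rt z))) +
  b z * ((f z - f (up z)) * (fk z - fk (up z)))).
have Tm0 z : 0 <= Tm z.
  by rewrite /Tm mulr_ge0 // addr_ge0 // mulr_ge0 // clamp_mono.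
have fkb z : - k <= fk z <= k by apply: clamp_bound.
have low z : Tm z - (k * t / 2 * energy_density a b f z + k / (2 * t) * energy_density a b chi z)
    <= J1 z * (g z - g (rt z)) + J2 z * (g z - g (up z)).
  have h1 := cutoff_term_bound (f z - f (rt z)) (fk z) (chi z) (chi (rt z)) t0 (fkb (rt z)) (a0 z).
  have h2 := cutoff_term_bound (f z - f (up z)) (fk z) (chi z) (chi (up z)) t0 (fkb (up z)) (b0 z).
  apply: le_trans (lerD h1 h2); rewrite /Tm /energy_density le_eqVlt; apply/orP; left; apply/eqP.
  by move: (k * t / 2) (k / (2 * t)) => A B; ring.
have TE : Tm z0 = E0.
  by rewrite /Tm chi1 // mul1r /fk !clamp_id ?/k ?/E0 /energy_density ?expr2 //; lra.
have z0s : z0 \in s.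
  apply/inS/supnS; rewrite leNgt; apply/negP => /chiN; rewrite chi1 //.
  by move/eqP; rewrite oner_eq0.
have h1 := ler_term_sum us z0s Tm0; rewrite TE in h1.
have h2 := @ler_sum R Z2 s xpredT _ _ (fun z _ => low z).
rewrite parts sumrB big_split /= -!mulr_sumr in h2.
have h3 : k * t / 2 * \sum_(z <- s) energy_density a b f z <= E0 / 2.
  apply: (@le_trans _ _ (k * t / 2 * M)).
    by rewrite ler_wpM2l ?fM // divr_ge0 // mulr_ge0 // ltW.
  have -> : k * t / 2 * M = E0 / 2 * (M / (M + 1)) by rewrite /t; field; lra.
  rewrite ler_piMr //; first lra.
  by rewrite ler_pdivrMr; lra.
have h4 : k / (2 * t) * \sum_(z <- s) energy_density a b chi z <= E0 / 4.
  apply: (@le_trans _ _ (k / (2 * t) * e)).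
    by rewrite ler_wpM2l ?chie // divr_ge0 // mulr_ge0 // ltW.
  rewrite le_eqVlt; apply/orP; left; apply/eqP; rewrite /e; field.
  by rewrite gt_eqF //=; lra.
lra.
Qed.
End Liouville.

(** * Logarithmic cutoffs for bounded conductances *)

Section Cutoffs.
Variable R : realType.
Implicit Types (a b u f : Z2 -> R) (z : Z2).

Definition tent (L : nat) z : R :=
  Num.max 0 (Num.min 1 (2 - (supn z)%:~R / L%:R)).

Lemma tent_ge0 L z : 0 <= tent L z. Proof. by rewrite /tent le_max lexx. Qed.

Lemma tent_in (L : nat) z : (0 < L)%N -> supn z <= L%:Z -> tent L z = 1.
Proof.
move=> L0 h; rewrite /tent (min_idPl _) ?(max_idPr ler01) //.
have : (supn z)%:~R / L%:R <= 1 :> R.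
  by rewrite ler_pdivrMr ?ltr0n // mul1r -[L%:R]/(L%:Z%:~R) ler_int.
lra.
Qed.

Lemma tent_out (L : nat) z : (0 < L)%N -> (2 * L)%:Z <= supn z -> tent L z = 0.
Proof.
move=> L0 h; have h' : 2 <= (supn z)%:~R / L%:R :> R.
  rewrite ler_pdivlMr ?ltr0n // -[L%:R]/(L%:Z%:~R) -[2]/(2%:Z%:~R) -intrM ler_int; lia.
rewrite /tent; apply/max_idPl; rewrite ge_min; apply/orP; right; lra.
Qed.

Lemma ramp_lipschitz (p q : R) :
  `|Num.max 0 (Num.min 1 (2 - p)) - Num.max 0 (Num.min 1 (2 - q))| <= `|p - q|.
Proof.
wlog pq : p q / p <= q.
  move=> H; have [/H//|/ltW/H] := leP p q; by rewrite distrC [X in _ <= X]distrC.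
rewrite (ler0_norm (_ : p - q <= 0)) ?subr_le0 //.
rewrite ger0_norm; last first.
  rewrite subr_ge0 ge_max le_max lexx /= !le_max !le_min !ge_min lexx /=.
  by apply/orP; right; apply/orP; right; lra.
have [h3|h3] := leP 1 (2 - p); have [h4|h4] := leP 1 (2 - q); rewrite ?(max_idPr ler01); try lra.
- by have [h5|h5] := leP 0 (2 - q); lra.
- by have [h5|h5] := leP 0 (2 - q); have [h6|h6] := leP 0 (2 - p); lra.
Qed.

Lemma tent_lipschitz (L : nat) z w : (0 < L)%N -> Z2_adj z w ->
  (tent L z - tent L w) ^+ 2 <= L%:R ^- 2.
Proof.
move=> L0 /lipschitz1_supn h.
have Lp : 0 < L%:R :> R by rewrite ltr0n.
have h1 : `|(supn z)%:~R / L%:R - (supn w)%:~R / L%:R| <= L%:R^-1 :> R.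
  rewrite -mulrBl normrM [X in _ * X]ger0_norm ?invr_ge0 ?(ltW Lp) //.
  by rewrite ler_piMl ?invr_ge0 ?(ltW Lp) // -intrB -intr_norm -[1]/(1%:~R) ler_int.
suff h2 : `|tent L z - tent L w| <= L%:R^-1.
  by rewrite -[X in X ^+ 2]/(_) -real_normK ?num_real // -exprVn lerXn2r ?nnegrE ?invr_ge0 ?(ltW Lp).
by apply: le_trans h1; apply: ramp_lipschitz.
Qed.

(** At most [(4 * L + 1) ^ 2 <= 25 * L ^ 2] points contribute, each at most [2 / L ^ 2]: in
    dimension two the bound does not depend on the scale. *)
Lemma tent_energy a b (L : nat) : (0 < L)%N -> (forall z, 0 <= a z <= 1) ->
  (forall z, 0 <= b z <= 1) -> energy_le a b (tent L) 50.
Proof.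
move=> L0 ha hb s us.
have Lp : 0 < L%:R :> R by rewrite ltr0n.
pose t := [seq z <- s | supn z <= (2 * L)%:Z].
have ut : uniq t by rewrite filter_uniq.
have tB : {subset t <= rect_seq (- (2 * L)%:Z) (2 * L)%:Z (- (2 * L)%:Z) (2 * L)%:Z}.
  by move=> z; rewrite mem_filter => /andP[/rect_seq_supn].
have sz : (size t <= (4 * L + 1) * (4 * L + 1))%N.
  apply: leq_trans (uniq_leq_size ut tB) _.
  by rewrite size_allpairs !size_iota; apply: leq_mul; lia.
have dens z : energy_density a b (tent L) z <= if supn z <= (2 * L)%:Z then 2 * L%:R ^- 2 else 0.
  rewrite /energy_density; have /andP[a0 a1] := ha z; have /andP[b0 b1] := hb z.
  case: ifP => h.
    have h1 : (tent L z - tent L (rt z)) ^+ 2 <= L%:R ^- 2.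
      by apply: tent_lipschitz => //; rewrite /Z2_adj /=; lia.
    have h2 : (tent L z - tent L (up z)) ^+ 2 <= L%:R ^- 2.
      by apply: tent_lipschitz => //; rewrite /Z2_adj /=; lia.
    have h3 := ler_pM a0 (sqr_ge0 _) a1 h1; have h4 := ler_pM b0 (sqr_ge0 _) b1 h2.
    lra.
  have e0 : tent L z = 0 by apply: tent_out => //; lia.
  have e1 : tent L (rt z) = 0 by apply: tent_out => //; move: h; rewrite /supn /=; lia.
  have e2 : tent L (up z) = 0 by apply: tent_out => //; move: h; rewrite /supn /=; lia.
  by rewrite e0 e1 e2 subrr expr0n /= !mulr0 addr0.
apply: le_trans (ler_sum _ (fun z _ => dens z)) _.
rewrite -big_mkcond /= -big_filter -/t big_const_seq count_predT.
rewrite -Monoid.iteropE /= -[X in X <= _]/((2 * L%:R ^- 2) *+ size t).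
apply: (@le_trans _ _ ((2 * L%:R ^- 2) *+ ((4 * L + 1) * (4 * L + 1)))).
  by apply: ler_wpMn2l => //; rewrite mulr_ge0 // invr_ge0 exprn_ge0 // ltW.
rewrite -mulr_natr natrM natrD natrM.
have L1 : 1 <= L%:R :> R by rewrite ler1n.
rewrite mulrAC -ler_pdivlMr ?invr_gt0 ?exprn_gt0 // invrK; nra.
Qed.

(* Averaging tents at increasing scales: their gradients have disjoint supports, so
   the energy of the average of [m] of them is [1/m] times that of one tent. *)
Lemma bounded_conductances_cutoffs a b : (forall z, 0 <= a z <= 1) ->
  (forall z, 0 <= b z <= 1) -> has_cutoffs a b.
Proof.
move=> ha hb n e e0.
have step m : exists (chi : Z2 -> R) (N : nat),
    [/\ forall z, 0 <= chi z, forall z, supn z <= n%:Z -> chi z = 1,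
    forall z, N%:Z < supn z -> chi z = 0 & energy_le a b chi (50 / m.+1%:R)].
  elim: m => [|m [chi [N [c0 c1 cN ce]]]].
    exists (tent n.+1), (2 * n.+1)%N; split.
    - exact: tent_ge0.
    - by move=> z h; apply: tent_in => //; lia.
    - by move=> z h; apply: tent_out => //; lia.
    - by rewrite divr1; apply: tent_energy.
  (* The new tent equals 1 on the support of [chi] and next to it. The weight [1 / (m + 2)] turns
     the energies [50 / (m + 1)] and 50 into [50 / (m + 2)]. *)
  pose L := maxn N.+1 n.+1; pose th : R := m.+2%:R^-1.
  have mp : 0 < m.+2%:R :> R by rewrite ltr0n.
  have mp1 : 0 < m.+1%:R :> R by rewrite ltr0n.
  have th0 : 0 <= th by rewrite /th invr_ge0 ltW.
  have th1 : th <= 1 by rewrite /th invf_le1 // ler1n.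
  have L0 : (0 < L)%N by rewrite /L; lia.
  exists (fun z => (1 - th) * chi z + th * tent L z), (2 * L)%N; split.
  - by move=> z; rewrite addr_ge0 // mulr_ge0 ?tent_ge0 // subr_ge0.
  - move=> z h; rewrite c1 // tent_in //; first by ring.
    by rewrite /L; lia.
  - move=> z h; rewrite cN ?tent_out ?mulr0 ?addr0 //; first by lia.
    by move: h; rewrite /L; lia.
  move=> s us.
  have loc z w : Z2_adj z w ->
      ((1 - th) * chi z + th * tent L z - ((1 - th) * chi w + th * tent L w)) ^+ 2 =
      (1 - th) ^+ 2 * (chi z - chi w) ^+ 2 + th ^+ 2 * (tent L z - tent L w) ^+ 2.
    move=> zw; suff : (chi z - chi w) * (tent L z - tent L w) = 0.
      move=> h; rewrite -[RHS]addr0 -[0](mulr0 (2 * (1 - th) * th)) -h; ring.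
    have hzw := lipschitz1_supn zw.
    have [hz|hz] := leP (supn z) N%:Z.
      by rewrite (@tent_in L z) ?(@tent_in L w) ?subrr ?mulr0 // /L; lia.
    have [hw|hw] := leP (supn w) N%:Z.
      by rewrite (@tent_in L z) ?(@tent_in L w) ?subrr ?mulr0 // /L; lia.
    by rewrite !cN // subrr mul0r.
  have dE z : energy_density a b (fun z => (1 - th) * chi z + th * tent L z) z =
      (1 - th) ^+ 2 * energy_density a b chi z + th ^+ 2 * energy_density a b (tent L) z.
    rewrite /energy_density !loc; [ring| |]; by rewrite /Z2_adj /=; lia.
  rewrite (eq_bigr _ (fun z _ => dE z)) big_split /= -!mulr_sumr.
  apply: (@le_trans _ _ ((1 - th) ^+ 2 * (50 / m.+1%:R) + th ^+ 2 * 50)).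
    by apply: lerD; apply: ler_wpM2l; rewrite ?sqr_ge0 ?ce ?tent_energy.
  rewrite le_eqVlt; apply/orP; left; apply/eqP; rewrite /th -(natr1 m.+1).
  move: mp1; set x := m.+1%:R => x0; field; rewrite !gt_eqF //; lra.
have [m hm] : exists m : nat, 50 / m.+1%:R <= e.
  exists (Num.bound (50 / e)); rewrite ler_pdivrMr ?ltr0n // mulrC -ler_pdivrMr //.
  by apply/ltW/(lt_trans (archi_boundP _)); rewrite ?divr_ge0 ?(ltW e0) // ltr_nat.
have [chi [N [c0 c1 cN ce]]] := step m; exists chi, N; split=> //.
by move=> s us; apply: le_trans (ce s us) hm.
Qed.
End Cutoffs.

(** * Geometric series and cutoffs given by finite regions *)

Section GeometricSums.
Variable R : realType.

Lemma sum_geometric_nat (x : R) (u : seq nat) : 0 <= x < 1 -> uniq u ->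
  \sum_(k <- u) x ^+ k <= (1 - x)^-1.
Proof.
move=> /andP[x0 x1] uu.
have tel K : (\sum_(k <- iota 0 K) x ^+ k) * (1 - x) = 1 - x ^+ K.
  elim: K => [|K IH]; first by rewrite big_nil mul0r expr0 subrr.
  by rewrite -addn1 iotaD big_cat big_seq1 /= add0n mulrDl IH addn1 exprS; ring.
pose K := (\max_(k <- u) k).+1.
apply: (@le_trans _ _ (\sum_(k <- iota 0 K) x ^+ k)).
  apply: ler_sum_subset; rewrite ?iota_uniq // => k; last by rewrite exprn_ge0.
  by move=> ku; rewrite mem_iota /= add0n ltnS; apply: leq_bigmax_seq.
by rewrite -[leRHS]mul1r ler_pdivlMr ?subr_gt0 // tel gerBl exprn_ge0.
Qed.

Lemma sum_geometric_int (x : R) (t : seq int) : 0 <= x < 1 -> uniq t ->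
  \sum_(i <- t) x ^+ `|i|%N <= 2 * (1 - x)^-1.
Proof.
move=> x01 ut; rewrite (bigID (fun i : int => 0 <= i)) /= mulr_natl mulr2n.
have part (p : pred int) : (forall i j, p i -> p j -> `|i|%N = `|j|%N -> i = j) ->
    \sum_(i <- t | p i) x ^+ `|i|%N <= (1 - x)^-1.
  move=> ip; rewrite -big_filter -(big_map absz xpredT (fun k => x ^+ k)).
  apply: sum_geometric_nat => //; rewrite map_inj_in_uniq ?filter_uniq // => i j.
  by rewrite !mem_filter => /andP[pi _] /andP[pj _]; apply: ip.
by apply: lerD; apply: part => i j /=; lia.
Qed.

Lemma sum_geometric_Z2 (x : R) (s : seq Z2) : 0 <= x < 1 -> uniq s ->
  \sum_(z <- s) x ^+ (`|z.1| + `|z.2|)%N <= (2 * (1 - x)^-1) ^+ 2.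
Proof.
move=> x01 us; have /andP[x0 _] := x01.
pose t1 := undup (map fst s); pose t2 := undup (map snd s).
have h : \sum_(z <- [seq (i, j) | i <- t1, j <- t2]) x ^+ (`|z.1| + `|z.2|)%N =
    (\sum_(i <- t1) x ^+ `|i|%N) * (\sum_(j <- t2) x ^+ `|j|%N).
  rewrite big_allpairs mulr_suml; apply: eq_bigr => i _.
  by rewrite mulr_sumr; apply: eq_bigr => j _; rewrite exprD.
apply: (@le_trans _ _ (\sum_(z <- [seq (i, j) | i <- t1, j <- t2]) x ^+ (`|z.1| + `|z.2|)%N)).
  apply: ler_sum_subset => //.
  - by apply: allpairs_uniq; rewrite ?undup_uniq // => -[i j] [i' j'].
  - move=> z zs; apply/allpairsP; exists z; rewrite !mem_undup !map_f //.
    by split=> //; case: z {zs}.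
  - by move=> z; rewrite exprn_ge0.
rewrite h expr2; apply: ler_pM; try by apply: sumr_ge0 => *; rewrite exprn_ge0.
  by apply: sum_geometric_int; rewrite ?undup_uniq.
by apply: sum_geometric_int; rewrite ?undup_uniq.
Qed.

Lemma geometric_tail (x C e : R) (n : nat) : 0 < x < 1 -> 0 <= C -> 0 < e ->
  exists2 m : nat, (n <= m)%N & forall s : seq Z2, uniq s ->
    (forall z, z \in s -> m%:Z <= supn z) ->
    \sum_(z <- s) C * x ^+ `|supn z|%N <= e.
Proof.
move=> /andP[x0 x1] C0 e0.
(* With [y ^+ 4 = x], and since [m <= supn z] and [|z.1| + |z.2| <= 2 * supn z], the term is at most
   [C * y ^+ m * y ^+ (|z.1| + |z.2|)]: one power is small, the other summable. *)
pose y := Num.sqrt (Num.sqrt x).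
have y0 : 0 < y by rewrite !sqrtr_gt0.
have y4 : y ^+ 4 = x by rewrite (exprM y 2 2) !sqr_sqrtr ?sqrtr_ge0 // ltW.
have y1 : y < 1.
  rewrite ltNge; apply/negP => h; have := exprn_ege1 4 h; rewrite y4; lra.
have y01 : 0 <= y < 1 by rewrite ltW.
pose S := (2 * (1 - y)^-1) ^+ 2.
have S0 : 0 <= S by rewrite sqr_ge0.
have [m nm hm] : exists2 m : nat, (n <= m)%N & C * S * y ^+ m <= e.
  have [h|h] := leP (C * S) 0.
    by exists n => //; apply: (@le_trans _ _ 0); rewrite ?(ltW e0) // mulr_le0_ge0 // exprn_ge0 // ltW.
  have : ~ (forall k, e / (C * S) <= y ^+ k).
    by move/(expr_bound_le0 y01); rewrite leNgt divr_gt0.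
  move/existsNP => [k /negP]; rewrite -ltNge => hk.
  exists (n + k)%N; first by lia.
  rewrite mulrC -ler_pdivlMr //; apply: le_trans (ltW hk).
  by rewrite exprD ler_piMl ?exprn_ge0 ?exprn_ile1 // ltW.
exists m => // s us hs.
apply: (@le_trans _ _ (\sum_(z <- s) C * y ^+ m * y ^+ (`|z.1| + `|z.2|)%N)).
  rewrite big_seq [leRHS]big_seq; apply: ler_sum => z /hs hz.
  rewrite -mulrA ler_wpM2l // -y4 -exprM -exprD; apply: ler_wiXn2l; rewrite ?(ltW y0) ?(ltW y1) //.
  by move: hz; rewrite /supn; lia.
rewrite -mulr_sumr; apply: le_trans hm.
rewrite -mulrA -mulrA ler_wpM2l // mulrC ler_wpM2r ?exprn_ge0 ?(ltW y0) //.
exact: sum_geometric_Z2.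
Qed.

(** The cutoff is the indicator of [D], whose energy is the total conductance of its boundary. As
    [D] contains the box [m], this is bounded by the tail of a geometric series. *)
Lemma confined_cutoffs (a b : Z2 -> R) (x C : R) : 0 < x < 1 -> 0 <= C ->
  (forall z, 0 <= a z) -> (forall z, 0 <= b z) ->
  (forall n : nat, exists (D : pred Z2) (N : nat),
    [/\ forall z, supn z <= n%:Z -> D z, forall z, D z -> supn z <= N%:Z,
        forall z, D z != D (rt z) -> a z <= C * x ^+ `|supn z|%N &
        forall z, D z != D (up z) -> b z <= C * x ^+ `|supn z|%N]) ->
  has_cutoffs a b.
Proof.
move=> x01 C0 a0 b0 hD n e e0.
have [m nm tail] := geometric_tail n x01 (mulr_ge0 (ler0n R 2) C0) e0.
have [D [N [Dm DN aD bD]]] := hD m.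
exists (fun z => (D z)%:R), N; split.
- by move=> z.
- by move=> z h; rewrite Dm //; lia.
- by move=> z; case: (boolP (D z)) => // /DN; lia.
move=> s us.
have x0 : 0 <= x by lra.
have p0 z : 0 <= C * x ^+ `|supn z|%N by rewrite mulr_ge0 // exprn_ge0.
have dens z : energy_density a b (fun z => (D z)%:R) z <=
    if m%:Z <= supn z then 2 * C * x ^+ `|supn z|%N else 0.
  rewrite /energy_density; case: ifP => h.
    have h1 : a z * ((D z)%:R - (D (rt z))%:R) ^+ 2 <= C * x ^+ `|supn z|%N.
      have [e1|/[dup] /aD h1 ne] := eqVneq (D z) (D (rt z)); first by rewrite e1 subrr expr0n mulr0.
      apply: le_trans h1; rewrite ler_piMr //.
      by move: ne; case: (D z); case: (D (rt z)) => // _; rewrite ?subr0 ?sub0r ?sqrrN expr1n.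
    have h2 : b z * ((D z)%:R - (D (up z))%:R) ^+ 2 <= C * x ^+ `|supn z|%N.
      have [e1|/[dup] /bD h2 ne] := eqVneq (D z) (D (up z)); first by rewrite e1 subrr expr0n mulr0.
      apply: le_trans h2; rewrite ler_piMr //.
      by move: ne; case: (D z); case: (D (up z)) => // _; rewrite ?subr0 ?sub0r ?sqrrN expr1n.
    lra.
  rewrite !Dm ?subrr ?expr0n /= ?mulr0 ?addr0 //; move: h; rewrite /supn /=; lia.
apply: le_trans (ler_sum _ (fun z _ => dens z)) _.
rewrite -big_mkcond -big_filter; apply: tail; first by rewrite filter_uniq.
by move=> z; rewrite mem_filter => /andP[].
Qed.

End GeometricSums.

(** * Planar duality of networks *)

Section Conjugate.
Variable R : realFieldType.

Lemma primitive_int (u : int -> R) : exists v : int -> R,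
  v 0 = 0 /\ forall k, v k - v (k - 1) = u k.
Proof.
pose v (k : int) := match k with
  | Posz n => \sum_(i < n) u i.+1%:Z
  | Negz n => - \sum_(i < n.+1) u (- i%:Z) end.
exists v; split; first by rewrite /v /= big_ord0.
case=> [[|n]|n].
- by rewrite -[0%:Z - 1]/(Negz 0) /v /= big_ord0 big_ord_recl big_ord0 /= addr0 opprK add0r oppr0.
- have -> : n.+1%:Z - 1 = n%:Z by lia.
  by rewrite /v big_ord_recr /= [LHS]addrC addKr.
- have -> : Negz n - 1 = Negz n.+1 by lia.
  by rewrite /v /= opprK [X in _ + X]big_ord_recr /= addKr; congr u; lia.
Qed.

(* The flow of a harmonic function is the rotated gradient of its harmonic
   conjugate, a function of the faces. *)
Lemma harmonic_conjugate (J1 J2 : Z2 -> R) :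
  (forall z, J1 z - J1 (lf z) + (J2 z - J2 (dn z)) = 0) ->
  exists g : Z2 -> R, (forall z, g z - g (dn z) = J1 z) /\
    (forall z, g z - g (lf z) = - J2 z).
Proof.
move=> div.
have [h [h0 hE]] := primitive_int (fun k => - J2 (k, 0)).
have /choice[v hv] : forall i : int, exists v : int -> R,
    v 0 = 0 /\ forall k, v k - v (k - 1) = J1 (i, k).
  by move=> i; apply: (primitive_int (fun k => J1 (i, k))).
exists (fun z => h z.1 + v z.1 z.2); split=> -[i j] /=.
  by have [_ <-] := hv i; rewrite opprD addrACA subrr add0r.
(* The increment between neighbouring columns is known at height 0, and the vanishing divergence
   propagates it up and down. *)
have key k : v i k - v (i - 1) k = J2 (i, 0) - J2 (i, k).
  have step l : v i l - v (i - 1) l - (v i (l - 1) - v (i - 1) (l - 1)) =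
      J2 (i, l - 1) - J2 (i, l).
    have [_ h1] := hv i; have [_ h2] := hv (i - 1).
    have := div (i, l); rewrite /lf /dn /= -(h1 l) -(h2 l) => e; lra.
  have v0 : v i 0 - v (i - 1) 0 = 0 by have [-> _] := hv i; have [-> _] := hv (i - 1); rewrite subrr.
  case: k => n; elim: n => [|n IH].
  - by rewrite v0 subrr.
  - have := step n.+1%:Z; have -> : n.+1%:Z - 1 = n%:Z by lia.
    rewrite IH; lra.
  - have := step 0; rewrite v0 sub0r -[- 1]/(Negz 0); lra.
  - have := step (Negz n); have -> : Negz n - 1 = Negz n.+1 by lia.
    rewrite IH; lra.
by have := hE i; have := key j; lra.
Qed.

(** The face indexed by [z] is the unit square with lower left corner [z]. The dual edge from it to
    the face [rt z] crosses the vertical edge at [rt z], that to the face [up z] the horizontal edge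
    at [up z]. *)
Definition dual1 (b : Z2 -> R) (z : Z2) : R := (b (rt z))^-1.
Definition dual2 (a : Z2 -> R) (z : Z2) : R := (a (up z))^-1.

(** On the dual network, the flow of the conjugate [g] is the rotated gradient of [f]. It is
    divergence free because a gradient has no circulation around a face, and its energy consists of
    the energies of [f] on the crossed edges; so [harmonic_constant] applies to [g]. *)
Lemma harmonic_constant_dual (a b f : Z2 -> R) (M : R) :
  (forall z, 0 < a z) -> (forall z, 0 < b z) -> network_harmonic a b f ->
  energy_le a b f M -> has_cutoffs (dual1 b) (dual2 a) ->
  forall z, energy_density a b f z = 0.
Proof.
move=> a0 b0 hf fM cut.
pose J1 z := a z * (f z - f (rt z)); pose J2 z := b z * (f z - f (up z)).
have [z|g [g1 g2]] := @harmonic_conjugate J1 J2; first by rewrite /J1 /J2 lfK dnK hf.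
have gr z : g z - g (rt z) = J2 (rt z) by have := g2 (rt z); rewrite rtK; lra.
have gu z : g z - g (up z) = - J1 (up z) by have := g1 (up z); rewrite upK; lra.
have an z : a z != 0 by rewrite gt_eqF.
have bn z : b z != 0 by rewrite gt_eqF.
have E1 z : dual1 b z * (g z - g (rt z)) = f (rt z) - f (up (rt z)).
  by rewrite gr /dual1 /J2 mulKf.
have E2 z : dual2 a z * (g z - g (up z)) = f (rt (up z)) - f (up z).
  by rewrite gu /dual2 /J1 -mulrN mulKf // opprB.
have dens z : energy_density (dual1 b) (dual2 a) g z =
    b (rt z) * (f (rt z) - f (up (rt z))) ^+ 2 + a (up z) * (f (up z) - f (rt (up z))) ^+ 2.
  rewrite /energy_density !expr2 !mulrA E1 E2 gr gu /J1 /J2; ring.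
have hg : network_harmonic (dual1 b) (dual2 a) g.
  move=> z; rewrite E1 E2.
  have := E1 (lf z); rewrite lfK => ->; have := E2 (dn z); rewrite dnK => ->.
  by rewrite /rt /lf /up /dn /=; ring.
have a0' z := ltW (a0 z); have b0' z := ltW (b0 z).
have gM : energy_le (dual1 b) (dual2 a) g (M + M).
  move=> s us.
  apply: (@le_trans _ _ (\sum_(z <- s) energy_density a b f (rt z) + \sum_(z <- s) energy_density a b f (up z))).
    rewrite -big_split /=; apply: ler_sum => z _; rewrite dens /energy_density.
    have p1 : 0 <= a (rt z) * (f (rt z) - f (rt (rt z))) ^+ 2 by rewrite mulr_ge0 ?sqr_ge0.
    have p2 : 0 <= b (up z) * (f (up z) - f (up (up z))) ^+ 2 by rewrite mulr_ge0 ?sqr_ge0.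
    lra.
  rewrite -(big_map rt xpredT (energy_density a b f)) -(big_map up xpredT (energy_density a b f)).
  by apply: lerD; apply: fM; rewrite map_inj_uniq //; [exact: can_inj rtK|exact: can_inj upK].
have d1 z : 0 <= dual1 b z by rewrite /dual1 invr_ge0.
have d2 z : 0 <= dual2 a z by rewrite /dual2 invr_ge0.
have H := harmonic_constant d1 d2 hg gM cut.
have pa z d : 0 <= a z * d ^+ 2 by rewrite mulr_ge0 ?sqr_ge0.
have pb z d : 0 <= b z * d ^+ 2 by rewrite mulr_ge0 ?sqr_ge0.
move=> z; apply/eqP; rewrite /energy_density paddr_eq0 ?pa ?pb //.
have := H (dn z); have := H (lf z); rewrite !dens dnK lfK.
move=> /eqP; rewrite paddr_eq0 ?pa ?pb // => /andP[-> _].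
by move=> /eqP; rewrite paddr_eq0 ?pa ?pb // => /andP[_ /eqP ->]; rewrite eqxx.
Qed.

End Conjugate.

(** * Currents on the disordered network *)

Section Currents.
Variable R : realType.
Implicit Types (c : {fset Z2} -> R) (z : Z2).

Lemma Z2_adj_neighbours (x y : Z2) :
  Z2_adj x y = (y \in [:: rt x; lf x; up x; dn x]).
Proof.
rewrite !inE -!pair_eqE /Z2_adj /rt /lf /up /dn /=.
case: x y => [x1 x2] [y1 y2] /=; lia.
Qed.

Lemma neighbours_uniq (x : Z2) : uniq [:: rt x; lf x; up x; dn x].
Proof.
rewrite /= !inE -!pair_eqE /rt /lf /up /dn /=; case: x => [x1 x2] /=; lia.
Qed.

Lemma dstarE (i : Z2 -> Z2 -> R) (x : Z2) :
  dstar Z2_adj i x = i x (rt x) + i x (lf x) + (i x (up x) + i x (dn x)).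
Proof.
rewrite /dstar (_ : [set y | Z2_adj x y] = [set` [:: rt x; lf x; up x; dn x]]).
  by rewrite -fsbig_seq ?neighbours_uniq // !big_cons big_nil /= addr0 !addrA.
by apply/seteqP; split => y /=; rewrite Z2_adj_neighbours.
Qed.

Definition cond1 c z : R := c [fset z; rt z].
Definition cond2 c z : R := c [fset z; up z].

Lemma current_energy c i v : (forall e, 0 < c e) ->
  (forall x y, Z2_adj x y -> i x y = c [fset x; y] * (v x - v y)) ->
  (energy Z2_adj c i < +oo)%E -> exists M, energy_le (cond1 c) (cond2 c) v M.
Proof.
move=> c0 iv; rewrite /energy; set E := esum _ _ => hE.
pose F (q : Z2 * Z2) := i q.1 q.2 ^+ 2 * resistance c [fset q.1; q.2].
have F0 q : (0 <= (F q)%:E)%E by rewrite lee_fin mulr_ge0 ?sqr_ge0 // invr_ge0 ltW.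
have E0 : (0 <= E)%E by apply: esum_ge0 => q _; apply: F0.
have Efin : E \is a fin_num.
  rewrite ge0_fin_numE //; case: E hE E0 => // [r _ _|]; first exact: ltry.
  by rewrite gt0_muley ?lte_fin.
exists (fine E) => s us.
(* Each edge is listed in one orientation, so the sum over all arcs, without the factor 1/2, is a
   bound. *)
pose L := [seq (z, rt z) | z <- s] ++ [seq (z, up z) | z <- s].
have inj g : injective (fun z : Z2 => (z, g z) : Z2 * Z2) by move=> x y [].
have uL : uniq L.
  rewrite cat_uniq !map_inj_uniq // us andbT /=; apply/hasPn => q /mapP[z _ ->].
  apply/negP => /mapP[w _ [<-]]; rewrite /up /rt; case: z => z1 z2 /= []; lia.
have LA : [set` L] `<=` arcs Z2_adj.
  move=> q /=; rewrite mem_cat => /orP[] /mapP[z _ ->]; rewrite /arcs /=;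
  by rewrite Z2_adj_neighbours !inE eqxx ?orbT.
have -> : \sum_(z <- s) energy_density (cond1 c) (cond2 c) v z = \sum_(q <- L) F q.
  rewrite big_cat !big_map /= -big_split; apply: eq_bigr => z _ /=.
  rewrite /F /resistance /= !iv ?Z2_adj_neighbours ?inE ?eqxx ?orbT //.
  have h1 := c0 [fset z; rt z]; have h2 := c0 [fset z; up z].
  by rewrite /energy_density /cond1 /cond2; field; rewrite !gt_eqF.
rewrite -lee_fin fineK // -sumEFin; apply: esum_ge.
by exists [set` L]; [split=> //; exact: finite_seq|rewrite fsbig_seq].
Qed.

Lemma unique_currents_harmonic c : (forall e, 0 < c e) ->
  (forall f M, network_harmonic (cond1 c) (cond2 c) f ->
     energy_le (cond1 c) (cond2 c) f M ->
     forall z, energy_density (cond1 c) (cond2 c) f z = 0) ->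
  unique_currents Z2_adj c.
Proof.
move=> c0 H i i' [_ [v iv] Ei] [_ [v' iv'] Ei'] dd.
have [M hM] := current_energy c0 iv Ei; have [M' hM'] := current_energy c0 iv' Ei'.
pose f z := v z - v' z.
have nb z : [/\ Z2_adj z (rt z), Z2_adj z (lf z), Z2_adj z (up z) & Z2_adj z (dn z)].
  by rewrite !Z2_adj_neighbours !inE !eqxx !orbT.
have hf : network_harmonic (cond1 c) (cond2 c) f.
  move=> z; have [n1 n2 n3 n4] := nb z.
  have := dd z; rewrite !dstarE !iv // !iv' // /cond1 /cond2 lfK dnK /f.
  by rewrite (fsetUC [fset lf z]) (fsetUC [fset dn z]) => e; lra.
have c1 z : 0 < cond1 c z by apply: c0.
have c2 z : 0 < cond2 c z by apply: c0.
have fM : energy_le (cond1 c) (cond2 c) f (2 * M + 2 * M').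
  move=> s us; apply: le_trans (lerD (ler_wpM2l (ler0n R 2) (hM s us))
    (ler_wpM2l (ler0n R 2) (hM' s us))).
  rewrite !mulr_sumr -big_split; apply: ler_sum => z _ /=.
  have sq (q x y : R) : 0 < q -> q * (x - y) ^+ 2 <= 2 * (q * x ^+ 2) + 2 * (q * y ^+ 2).
    move=> q0; rewrite -subr_ge0; have -> : 2 * (q * x ^+ 2) + 2 * (q * y ^+ 2) - q * (x - y) ^+ 2 = q * (x + y) ^+ 2 by ring.
    by rewrite mulr_ge0 ?sqr_ge0 // ltW.
  have h1 := sq _ (v z - v (rt z)) (v' z - v' (rt z)) (c1 z).
  have h2 := sq _ (v z - v (up z)) (v' z - v' (up z)) (c2 z).
  rewrite /energy_density /f.
  have -> : v z - v' z - (v (rt z) - v' (rt z)) = v z - v (rt z) - (v' z - v' (rt z)) by ring.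
  have -> : v z - v' z - (v (up z) - v' (up z)) = v z - v (up z) - (v' z - v' (up z)) by ring.
  lra.
have Z := H f _ hf fM.
have fr z : f z = f (rt z) /\ f z = f (up z).
  have := Z z; rewrite /energy_density => /eqP.
  rewrite paddr_eq0; try by rewrite mulr_ge0 ?sqr_ge0 // ltW.
  rewrite (mulf_eq0 (cond1 c z)) (mulf_eq0 (cond2 c z)) !sqrf_eq0 !subr_eq0.
  by rewrite (gt_eqF (c1 z)) (gt_eqF (c2 z)) /= => /andP[/eqP ? /eqP ?].
move=> x y xy; rewrite iv // iv' //.
suff : f x = f y by rewrite /f => e; congr (_ * _); lra.
move: xy; rewrite Z2_adj_neighbours !inE => /or4P[] /eqP ->.
- by have [] := fr x.
- by have [] := fr (lf x); rewrite lfK.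
- by have [] := fr x.
- by have [_] := fr (dn x); rewrite dnK.
Qed.

End Currents.

(** * Graph distance and clusters on the square lattice *)

Lemma nat_minP (A : set nat) : A !=set0 -> A (nat_min A).
Proof.
move=> [n An]; rewrite /nat_min.
have ex : exists m, `[< A m >] by exists n; apply/asboolP.
case: (ex_minnP ex) => m /asboolP Am mmin.
case: xgetP => [k _ [] //|/(_ m)[]]; split=> // k Ak.
by apply: mmin; apply/asboolP.
Qed.

Lemma Z2_connected (x : Z2) : exists s, path Z2_adj x s /\ last x s = Z2_origin.
Proof.
have [n] : exists n : nat, (`|x.1| + `|x.2| <= n)%N by eexists.
elim: n x => [|n IH] x hx.
  by exists [::]; split=> //; case: x hx => [x1 x2] /= hx; apply/eqP; rewrite -pair_eqE /=; lia.
have step y : Z2_adj x y -> (`|y.1| + `|y.2| <= n)%N ->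
    exists s, path Z2_adj x s /\ last x s = Z2_origin.
  by move=> xy /IH[s [ps ls]]; exists (y :: s); rewrite /= xy.
have [h1|h1] := ltP 0 x.1; first by apply: (step (lf x)); rewrite /Z2_adj /=; lia.
have [h2|h2] := ltP x.1 0; first by apply: (step (rt x)); rewrite /Z2_adj /=; lia.
have [h3|h3] := ltP 0 x.2; first by apply: (step (dn x)); rewrite /Z2_adj /=; lia.
have [h4|h4] := ltP x.2 0; first by apply: (step (up x)); rewrite /Z2_adj /=; lia.
by apply: IH; lia.
Qed.

Lemma supn_le_dist (x : Z2) : supn x <= (graph_dist Z2_adj x Z2_origin)%:Z.
Proof.
have : [set size s | s in [set s : seq Z2 | path Z2_adj x s /\ last x s = Z2_origin]]
    (graph_dist Z2_adj x Z2_origin).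
  by apply: nat_minP; have [s hs] := Z2_connected x; exists (size s), s.
move=> [s [ps ls] <-].
elim: s x ps ls => [|y s IH] x /=; first by move=> _ ->.
by move=> /andP[/lipschitz1_supn h /IH{}IH] /IH; lia.
Qed.

(** The successor accounts for the case where the minimum is attained at [y]. *)
Lemma supn_le_edge_dist (x y : Z2) : Z2_adj x y ->
  supn x <= (edge_dist Z2_adj Z2_origin [fset x; y]).+1%:Z.
Proof.
move=> /lipschitz1_supn h; rewrite /edge_dist.
set A := image _ _; have [z /= hz <-] : A (nat_min A).
  by apply: nat_minP; exists (graph_dist Z2_adj x Z2_origin), x; rewrite //= !inE eqxx.
have := supn_le_dist z; move: hz; rewrite !inE => /orP[] /eqP ->; lia.
Qed.

Definition doubled (z : Z2) : Z2 := (2 * z.1, 2 * z.2).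

(** [D] consists of the vertices joined to the box [r] of the doubled lattice, hence the factor 2.
    It is bounded by [trapped], and an open midpoint between two vertices puts both or neither in
    the cluster. *)
Lemma trapped_cluster (c : coloring) (r Rr : int) (n : nat) :
  proper_coloring c -> trapped c r Rr -> (2 * n)%:Z <= r ->
  exists (D : pred Z2) (N : nat),
  [/\ forall z, supn z <= n%:Z -> D z, forall z, D z -> supn z <= N%:Z,
      forall z, D z != D (rt z) -> ~~ c (2 * z.1 + 1, 2 * z.2) &
      forall z, D z != D (up z) -> ~~ c (2 * z.1, 2 * z.2 + 1)].
Proof.
move=> pc tr nr; pose C y := exists2 x, supn x <= r & conn c x y.
have cv z : c (doubled z) by apply: (pc _).1; rewrite /is_vertex /doubled /=; lia.
have Cadj x y : C x -> c y -> Z2_adj x y -> C y.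
  by move=> [u ur cu] cy xy; exists u => //; apply: conn_rcons xy.
have bd x y m : c m -> Z2_adj (doubled x) m -> Z2_adj (doubled y) m ->
    `[< C (doubled x) >] = `[< C (doubled y) >].
  move=> cm xm ym; apply/asbool_equiv_eq; split=> h.
    by apply: (Cadj m); [exact: Cadj xm|exact: cv|rewrite Z2_adjC].
  by apply: (Cadj m); [exact: Cadj ym|exact: cv|rewrite Z2_adjC].
exists (fun z => `[< C (doubled z) >]), `|Rr|%N; split.
- move=> z zn; apply/asboolP; exists (doubled z); last exact: conn_refl.
  by move: zn; rewrite /supn /doubled /=; lia.
- move=> z /asboolP[x xr /tr/(_ xr)]; rewrite /supn /doubled /=; lia.
- move=> z; apply: contra => cm; apply/eqP; apply: bd cm _ _; rewrite /Z2_adj /=; lia.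
- move=> z; apply: contra => cm; apply/eqP; apply: bd cm _ _; rewrite /Z2_adj /=; lia.
Qed.

Lemma edge_at1 (z : Z2) : edge_at (2 * z.1 + 1, 2 * z.2) = [fset z; rt z].
Proof.
rewrite /edge_at /rt /=; congr [fset _; _].
  by apply/eqP; rewrite -pair_eqE /=; lia.
by apply/eqP; rewrite -pair_eqE /=; lia.
Qed.

Lemma edge_at2 (z : Z2) : edge_at (2 * z.1, 2 * z.2 + 1) = [fset z; up z].
Proof.
rewrite /edge_at /up /=; congr [fset _; _].
  by apply/eqP; rewrite -pair_eqE /=; lia.
by apply/eqP; rewrite -pair_eqE /=; lia.
Qed.

(** * The disordered network at a fixed realization of the labels *)

Section DisorderedNetwork.
Variables (R : realType) (u : {fset Z2} -> R) (lambda1 lambda2 p : R).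
Hypotheses (lambda1_gt0 : 0 < lambda1) (lambda12 : lambda1 < lambda2).

Let c : {fset Z2} -> R :=
  disordered (Clambda Z2_adj Z2_origin lambda1) (Clambda Z2_adj Z2_origin lambda2) u p.

Let lambda2_gt0 : 0 < lambda2 := lt_trans lambda1_gt0 lambda12.

Lemma disorderedE e : c e =
  (if u e <= p then lambda1 else lambda2) ^- edge_dist Z2_adj Z2_origin e.
Proof.
rewrite /c /disordered /Clambda (_ : (e \in percolation u p) = (u e <= p)).
  by case: (u e <= p).
by apply/idP/idP => [/set_mem|?]; last exact: mem_set.
Qed.

Lemma disordered_gt0 e : 0 < c e.
Proof. by rewrite disorderedE; case: ifP => _; rewrite invr_gt0 exprn_gt0. Qed.

Lemma exprV_edge_dist (x : R) (z w : Z2) : 0 < x <= 1 -> Z2_adj z w ->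
  x ^+ edge_dist Z2_adj Z2_origin [fset z; w] <= x^-1 * x ^+ `|supn z|%N.
Proof.
move=> /andP[x0 x1] /supn_le_edge_dist; set n := edge_dist _ _ _ => h.
rewrite mulrC ler_pdivlMr // -exprSr; apply: ler_wiXn2l; rewrite ?x1 ?(ltW x0) //.
by move: h; rewrite /supn; clear; lia.
Qed.

Lemma unique_currents_lambda1_ge1 : 1 <= lambda1 -> unique_currents Z2_adj c.
Proof.
move=> l1; have c1 e : 0 <= c e <= 1.
  rewrite ltW ?disordered_gt0 //= disorderedE invf_le1; last first.
    by case: ifP => _; rewrite exprn_gt0.
  by case: ifP => _; rewrite exprn_ege1 // (le_trans l1) // ltW.
apply: unique_currents_harmonic; first exact: disordered_gt0.
move=> f M hf fM; apply: harmonic_constant hf fM _.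
- by move=> z; have /andP[] := c1 [fset z; rt z].
- by move=> z; have /andP[] := c1 [fset z; up z].
- by apply: bounded_conductances_cutoffs => z; apply: c1.
Qed.

Lemma unique_currents_lambda2_le1 : lambda2 <= 1 -> unique_currents Z2_adj c.
Proof.
move=> l2; have c1 e : 0 <= (c e)^-1 <= 1.
  rewrite invr_ge0 ltW ?disordered_gt0 //= disorderedE invrK.
  case: ifP => _; apply: exprn_ile1 => //; rewrite ?ltW //.
  exact: lt_le_trans lambda12 l2.
apply: unique_currents_harmonic; first exact: disordered_gt0.
move=> f M hf fM; apply: harmonic_constant_dual hf fM _.
- by move=> z; apply: disordered_gt0.
- by move=> z; apply: disordered_gt0.
- by apply: bounded_conductances_cutoffs => z; apply: c1.
Qed.

Let sg (z : Z2) : bool := u (edge_at z) <= 2^-1.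

Lemma coloring_edge1 z : coloring_of sg (2 * z.1 + 1, 2 * z.2) = (u [fset z; rt z] <= 2^-1).
Proof.
have e1 : is_vertex (2 * z.1 + 1, 2 * z.2) = false by rewrite /is_vertex /=; clear; lia.
have e2 : is_face (2 * z.1 + 1, 2 * z.2) = false by rewrite /is_face /=; clear; lia.
by rewrite /coloring_of e1 e2 /sg edge_at1.
Qed.

Lemma coloring_edge2 z : coloring_of sg (2 * z.1, 2 * z.2 + 1) = (u [fset z; up z] <= 2^-1).
Proof.
have e1 : is_vertex (2 * z.1, 2 * z.2 + 1) = false by rewrite /is_vertex /=; clear; lia.
have e2 : is_face (2 * z.1, 2 * z.2 + 1) = false by rewrite /is_face /=; clear; lia.
by rewrite /coloring_of e1 e2 /sg edge_at2.
Qed.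

Lemma unique_currents_subcritical : p <= 2^-1 -> 1 < lambda2 ->
  (forall M : nat, exists r Rr, M%:Z <= r /\ trapped (coloring_of sg) r Rr) ->
  unique_currents Z2_adj c.
Proof.
move=> ph l2 tr; apply: unique_currents_harmonic; first exact: disordered_gt0.
move=> f M hf fM; apply: harmonic_constant hf fM _; try by move=> z; apply/ltW/disordered_gt0.
have closed z w : Z2_adj z w -> ~~ (u [fset z; w] <= 2^-1) ->
    c [fset z; w] <= lambda2 * lambda2^-1 ^+ `|supn z|%N.
  move=> zw; rewrite -ltNge disorderedE => h.
  (* A label above 1/2 is above [p], so the conductance is that of [lambda2]. *)
  rewrite (lt_geF (le_lt_trans ph h)).
  rewrite -exprVn -[X in X * _]invrK; apply: exprV_edge_dist => //.
  by rewrite invr_gt0 lambda2_gt0 /= invf_le1 // ltW.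
apply: (@confined_cutoffs _ _ _ lambda2^-1 lambda2).
- by rewrite invr_gt0 lambda2_gt0 invf_lt1.
- exact: ltW.
- by move=> z; apply/ltW/disordered_gt0.
- by move=> z; apply/ltW/disordered_gt0.
move=> n; have [r [Rr [nr trap]]] := tr (2 * n)%N.
have [D [N [Dn DN D1 D2]]] := trapped_cluster (coloring_of_proper sg) trap nr.
exists D, N; split=> // z.
- by move=> /D1; rewrite coloring_edge1; apply: closed; rewrite /Z2_adj /=; lia.
- by move=> /D2; rewrite coloring_edge2; apply: closed; rewrite /Z2_adj /=; lia.
Qed.

Lemma unique_currents_supercritical : 2^-1 <= p -> lambda1 < 1 ->
  (forall M : nat, exists r Rr, M%:Z <= r /\
     trapped (fun z => ~~ coloring_of sg (translation 1 1 z)) r Rr) ->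
  unique_currents Z2_adj c.
Proof.
move=> ph l1 tr; apply: unique_currents_harmonic; first exact: disordered_gt0.
move=> f M hf fM; apply: harmonic_constant_dual hf fM _; try by move=> z; apply: disordered_gt0.
(* One factor for the gap between [supn] and the distance of the edge, one for passing from the end
   [z] of the crossed edge to the index [x] of the face. *)
pose C := lambda1^-1 * lambda1^-1.
have C0 : 0 <= C by rewrite mulr_ge0 // invr_ge0 ltW.
have l01 : 0 < lambda1 <= 1 by rewrite lambda1_gt0 ltW.
have opened z w x : Z2_adj z w -> Z2_adj x z -> u [fset z; w] <= 2^-1 ->
    (c [fset z; w])^-1 <= C * lambda1 ^+ `|supn x|%N.
  move=> zw xz h; rewrite disorderedE (le_trans h ph) invrK.
  apply: le_trans (exprV_edge_dist l01 zw) _; rewrite /C -mulrA ler_wpM2l ?invr_ge0 ?(ltW lambda1_gt0) //.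
  rewrite mulrC ler_pdivlMr // -exprSr; apply: ler_wiXn2l; rewrite ?(ltW lambda1_gt0) ?(ltW l1) //.
  by have := lipschitz1_supn xz; rewrite /supn; clear; lia.
apply: (@confined_cutoffs _ _ _ lambda1 C) => //.
- by rewrite lambda1_gt0.
- by move=> z; rewrite invr_ge0; apply/ltW/disordered_gt0.
- by move=> z; rewrite invr_ge0; apply/ltW/disordered_gt0.
move=> n; have [r [Rr [nr trap]]] := tr (2 * n)%N.
have pc : proper_coloring (fun z => ~~ coloring_of sg (translation 1 1 z)).
  move=> z; have [h1 h2] := coloring_of_proper sg (translation 1 1 z).
  by split=> h; rewrite ?negbK; [apply: h2|apply: h1]; move: h;
    rewrite /is_vertex /is_face /translation /=; clear; lia.
have [D [N [Dn DN D1 D2]]] := trapped_cluster pc trap nr.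
exists D, N; split=> // z.
- move=> /D1; rewrite negbK.
  (* The midpoint between the faces [z] and [rt z] is that of the primal edge in [dual1]. *)
  have -> : translation 1 1 (2 * z.1 + 1, 2 * z.2) = (2 * (rt z).1, 2 * (rt z).2 + 1).
    by rewrite /translation /rt /=; apply/eqP; rewrite -pair_eqE /=; lia.
  by rewrite coloring_edge2; apply: opened; rewrite /Z2_adj /=; lia.
- move=> /D2; rewrite negbK.
  have -> : translation 1 1 (2 * z.1, 2 * z.2 + 1) = (2 * (up z).1 + 1, 2 * (up z).2).
    by rewrite /translation /up /=; apply/eqP; rewrite -pair_eqE /=; lia.
  by rewrite coloring_edge1; apply: opened; rewrite /Z2_adj /=; lia.
Qed.

End DisorderedNetwork.

Theorem theorem2p7 (R : realType) (d : measure_display)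
    (Omega : measurableType d) (P : probability Omega R)
    (U : {fset Z2} -> {RV P >-> R})
    (iidU : iid_uniform01 (edges Z2_adj) U)
    (lambda1 lambda2 : R)
    (lambda1_gt0 : 0 < lambda1) (lambda12 : lambda1 < lambda2) :
  {ae P, forall w : Omega, forall p : R, 0 <= p <= 1 ->
    unique_currents Z2_adj
      (disordered (Clambda Z2_adj Z2_origin lambda1)
                  (Clambda Z2_adj Z2_origin lambda2)
                  (fun e => U e w) p)}.
Proof.
apply: filterS (ae_trapped iidU) => w tr p _.
have [l1|l1] := leP 1 lambda1; first exact: unique_currents_lambda1_ge1.
have [l2|l2] := leP lambda2 1; first exact: unique_currents_lambda2_le1.
have [ph|ph] := leP p 2^-1.
  by apply: unique_currents_subcritical => // M; have [] := tr M.
by apply: unique_currents_supercritical => //; [exact: ltW|move=> M; have [] := tr M].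
Qed.
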